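(* Let $(\mathcal{H},\lambda)$ be a weighted graph set such that either (Case 1) all graphs in $\mathcal{H}$ are reflexive, or (Case 2) all graphs in $\mathcal{H}$ are irreflexive and bipartite. Then for every $H\in\mathcal{H}$ with $\lambda(H)\neq0$, $\#\mathrm{Hom}^C(H)\le\#\mathrm{GSHom}^C((\mathcal{H},\lambda))$.
   Context: Graphs are finite, undirected, possibly with loops; reflexive means every vertex has a loop, irreflexive means none does; non-empty means at least one vertex. A homomorphism $h:V(G)\to V(J)$ maps every edge of $G$ to an edge of $J$; $\hom(G\to J)$ denotes their number. A weighted graph set is a pair $(\mathcal{H},\lambda)$ where $\mathcal{H}$ is a (finite) set of non-empty, pairwise non-isomorphic, connected graphs and $\lambda:\mathcal{H}\to\mathbb{Z}$. $\#\mathrm{GSHom}^C((\mathcal{H},\lambda))$: given an irreflexive connected graph $G$, output $0$ if $G$ is empty and $\sum_{J\in\mathcal{H}}\lambda(J)\hom(G\to J)$ otherwise. $\#\mathrm{Hom}^C(H)$: given a connected irreflexive graph $G$, output $\hom(G\to H)$. $P_1\le P_2$ denotes a polynomial-time Turing reduction from $P_1$ to $P_2$. *)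

(* Defs.v *)
From HB Require Import structures.
From mathcomp Require Import all_boot all_order all_algebra.

Set Implicit Arguments.
Unset Strict Implicit.
Unset Printing Implicit Defensive.

(* Finite undirected graphs; loops are allowed, and the graph may be empty. *)
Record graph := Graph {
  vertex :> finType;
  adj : rel vertex;
  adj_sym : symmetric adj
}.

Definition is_hom (G J : graph) (h : G -> J) : bool :=
  [forall x, forall y, adj x y ==> adj (h x) (h y)].

Definition hom (G J : graph) : nat := #|[set h : {ffun G -> J} | is_hom h]|.

Definition isomorphic (G J : graph) : Prop :=
  exists2 f : G -> J, bijective f & {mono f : x y / adj x y}.

Definition nonempty (G : graph) : Prop := 0 < #|G|.

(* The empty graph is connected: the problems below accept it as an input. *)
Definition connected (G : graph) : Prop :=
  forall x y : G, connect (@adj G) x y.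

Definition reflexive_graph (G : graph) : Prop := reflexive (@adj G).

Definition irreflexive_graph (G : graph) : Prop := irreflexive (@adj G).

Definition bipartite (G : graph) : Prop :=
  exists side : G -> bool, forall x y : G, adj x y -> side x != side y.

(* The set of graphs is given by an enumeration wgs_graph, which wgs_inj makes
   injective up to isomorphism. *)
Record weighted_graph_set := WeightedGraphSet {
  wgs_index : finType;
  wgs_graph : wgs_index -> graph;
  wgs_weight : wgs_index -> int;
  wgs_nonempty : forall i, nonempty (wgs_graph i);
  wgs_connected : forall i, connected (wgs_graph i);
  wgs_inj : forall i j, isomorphic (wgs_graph i) (wgs_graph j) -> i = j
}.

Definition bitstring := seq bool.

(* Binary expansion, least significant bit first, without leading zeros:
   up_log 2 n.+1 is the bit length of n. *)
Definition code_nat (n : nat) : bitstring :=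
  mkseq (fun i => odd (n %/ 2 ^ i)) (up_log 2 n.+1).

Definition code_int (z : int) : bitstring :=
  (z < 0)%R :: code_nat (absz z).

(* The number of vertices in unary, then the adjacency matrix row by row. *)
Definition code_graph (G : graph) : bitstring :=
  nseq #|G| true ++ false :: [seq adj x y | x <- enum G, y <- enum G].

(* A (promise) problem with integer outputs. *)
Record problem := Problem {
  instance : Type;
  code_instance : instance -> bitstring;
  output : instance -> int
}.

Record connected_irreflexive_graph := ConnectedIrreflexiveGraph {
  cig_graph :> graph;
  cig_connected : connected cig_graph;
  cig_irreflexive : irreflexive_graph cig_graph
}.

Definition HomC (H : graph) : problem :=
  @Problem connected_irreflexive_graph (fun G => code_graph G)
    (fun G => Posz (hom G H)).

Definition GSHomC (W : weighted_graph_set) : problem :=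
  @Problem connected_irreflexive_graph (fun G => code_graph G)
    (fun G => if #|G| == 0 then 0%R
      else (\sum_(i : wgs_index W)
              wgs_weight i * (Posz (hom G (wgs_graph i))))%R).

(* Tape cells hold a bit or a blank (None).  Tapes are infinite in both
   directions; the cells not listed are blank, and to_left lists the cells to
   the left of the head starting from the nearest one. *)
Definition symbol := option bool.

Record tape := Tape {
  to_left : seq symbol;
  scanned : symbol;
  to_right : seq symbol
}.

Variant direction := Left | Stay | Right.

Definition write (s : symbol) (t : tape) : tape :=
  Tape (to_left t) s (to_right t).

Definition move_head (d : direction) (t : tape) : tape :=
  match d with
  | Left => Tape (behead (to_left t)) (head None (to_left t))
                 (scanned t :: to_right t)
  | Stay => t
  | Right => Tape (scanned t :: to_left t) (head None (to_right t))
                  (behead (to_right t))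
  end.

Definition tape_of (w : bitstring) : tape :=
  Tape [::] (ohead w) (map Some (behead w)).

(* The string on a tape extends from the head up to the first blank. *)
Fixpoint read_until_blank (s : seq symbol) : bitstring :=
  if s is Some b :: s' then b :: read_until_blank s' else [::].

Definition string_on (t : tape) : bitstring :=
  read_until_blank (scanned t :: to_right t).

(* What a machine does in a given state: halt; query the oracle and go to the
   given state; or, depending on the scanned symbols, go to a new state and, on
   each tape, write a symbol and move the head. *)
Variant action (k : nat) (Q : Type) :=
  | Halt
  | Query of Q
  | Step of ({ffun 'I_k -> symbol} -> Q * ('I_k -> symbol * direction)).

(* Multi-tape oracle Turing machines.  Tape 0 is the input and output tape,
   tape 1 is the oracle tape, and there are om_work further tapes. *)
Record oracle_machine := OracleMachine {
  om_work : nat;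
  om_state : finType;
  om_start : om_state;
  om_action : om_state -> action om_work.+2 om_state
}.

Section Run.
Variables (M : oracle_machine) (f : bitstring -> bitstring).

Let tape_index := 'I_(om_work M).+2.

Definition io_tape : tape_index := ord0.
Definition oracle_tape : tape_index := lift ord0 ord0.

Record config := Config {
  cfg_state : om_state M;
  cfg_tapes : {ffun tape_index -> tape}
}.

Definition initial_config (w : bitstring) : config :=
  Config (om_start M)
    [ffun j => tape_of (if j == io_tape then w else [::])].

Definition halted (c : config) : bool :=
  if om_action (cfg_state c) is Halt then true else false.

(* A query replaces the string w on the oracle tape by f w in one step. *)
Definition next_config (c : config) : config :=
  let T := cfg_tapes c in
  match om_action (cfg_state c) with
  | Halt => c
  | Query q =>
      Config q [ffun j => if j == oracle_tape
                          then tape_of (f (string_on (T oracle_tape)))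
                          else T j]
  | Step delta =>
      let: (q, act) := delta [ffun j => scanned (T j)] in
      Config q [ffun j => move_head (act j).2 (write (act j).1 (T j))]
  end.

Definition computes_within (time : nat) (w v : bitstring) : Prop :=
  exists2 t, t <= time &
    let c := iter t next_config (initial_config w) in
    halted c /\ string_on (cfg_tapes c io_tape) = v.

End Run.

(* Nothing is assumed about the oracle on strings that encode no instance. *)
Definition solves (f : bitstring -> bitstring) (P : problem) : Prop :=
  forall x : instance P, f (code_instance x) = code_int (output x).

(* One machine and one polynomial time bound must work for every oracle that
   solves P2. *)
Definition poly_time_Turing_reducible (P1 P2 : problem) : Prop :=
  exists (M : oracle_machine) (c d : nat),
    forall f : bitstring -> bitstring, solves f P2 ->
    forall x : instance P1,
      let w := code_instance x in
      computes_within M f (c * size w ^ d + c) w (code_int (output x)).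

(* Main.v *)
Require Import Defs.
From HB Require Import structures.
From mathcomp Require Import all_boot all_order all_algebra.
From Stdlib Require Import Classical_Prop.
From mathcomp Require Import zify ring.

(** Call a gadget a graph [D] with a set [A] of marked vertices, such that adding a root
    adjacent to [A] makes it connected.  Glueing it to [G] joins [A] to a vertex [v] of [G], and

      hom(glue -> J) = sum over u in J of  g_D(J, u) * hom((G, v) -> (J, u)),

    where [g_D(J, u)] counts the homomorphisms from [D] to [J] sending [A] to neighbours of [u].
    The functions [g_D] on the pairs [(J, u)] are closed under products, since the product of two
    of them belongs to the disjoint union of the gadgets.  A rooted version of Lovász's argument
    shows that they separate [(J, u)] from [(J', u')] when [J] and [J'] are not isomorphic: the
    test graphs must be irreflexive, but loops of a test graph are irrelevant for reflexive
    targets and fatal for irreflexive ones.  So some integer combination of the [g_D] is a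
    nonzero constant on the pairs [(H, u)] and vanishes on all other pairs, which gives fixed
    gadgets, integers [m_a] and [d > 0] with

      sum over a of  m_a * GSHom(G glued to the a-th gadget) = d * hom(G -> H).

    The machine makes this fixed number of queries, stores the answers on separate tapes, and
    computes the combination and its exact quotient by [d] with a finite-state transducer that
    reads all answers in parallel from the least significant bit on. *)

Set Implicit Arguments.
Unset Strict Implicit.
Unset Printing Implicit Defensive.

Import Order.TTheory GRing.Theory Num.Theory.

Local Notation hom := Defs.hom.

(** * Homomorphism counts and gadgets *)

Lemma is_homP (G J : graph) (h : G -> J) :
  reflect {homo h : x y / adj x y} (is_hom h).
Proof.
apply: (iffP forallP) => [hh x y exy | hh x].
  by have /forallP/(_ y)/implyP := hh x; apply.
by apply/forallP => y; apply/implyP; apply: hh.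
Qed.

Lemma homo_connect (G J : graph) (h : G -> J) :
  {homo h : x y / adj x y} -> {homo h : x y / connect (@adj G) x y >-> connect (@adj J) x y}.
Proof.
move=> hh x y /connectP[p]; elim: p x => [|z p IHp] x /=; first by move=> _ ->.
move=> /andP[exz pz] ey; apply: (connect_trans (connect1 (hh _ _ exz))).
exact: IHp.
Qed.

Lemma connected_image (G J : graph) (h : G -> J) :
  {homo h : x y / adj x y} -> (forall y, exists x, h x = y) ->
  connected G -> connected J.
Proof.
move=> hh surj cG y y'; have [x <-] := surj y; have [x' <-] := surj y'.
exact: homo_connect.
Qed.

Lemma leq_card_cancel (S T : finType) (A : {set S}) (B : {set T})
    (f : S -> T) (g : T -> S) :
  {in A, forall x, f x \in B} -> {in A, cancel f g} -> #|A| <= #|B|.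
Proof.
move=> fAB fK; rewrite -(card_in_imset (can_in_inj fK)); apply: subset_leq_card.
by apply/subsetP=> _ /imsetP[x xA ->]; apply: fAB.
Qed.

Lemma eq_card_cancel (S T : finType) (A : {set S}) (B : {set T})
    (f : S -> T) (g : T -> S) :
  {in A, forall x, f x \in B} -> {in B, forall y, g y \in A} ->
  {in A, cancel f g} -> {in B, cancel g f} -> #|A| = #|B|.
Proof.
move=> fAB gBA fK gK; apply/eqP; rewrite eqn_leq.
by rewrite (leq_card_cancel fAB fK) (leq_card_cancel gBA gK).
Qed.

Section Join.
Variables (D G : graph) (c : D -> G -> bool).

(** The cross edges [c] are arbitrary, so that glueing at a root and disjoint union are both
    instances and share [split_fun]. *)
Definition join_adj (p q : D + G) : bool :=
  match p, q with
  | inl d, inl d' => adj d d'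
  | inl d, inr x => c d x
  | inr x, inl d => c d x
  | inr x, inr y => adj x y
  end.

Lemma join_adj_sym : symmetric join_adj.
Proof. by case=> [d|x] [d'|y] //=; rewrite adj_sym. Qed.

Definition join : graph := Graph join_adj_sym.

Variable J : graph.

Definition split_fun (h : {ffun join -> J}) : {ffun D -> J} * {ffun G -> J} :=
  ([ffun d => h (inl d)], [ffun x => h (inr x)]).

Lemma split_fun_bij : bijective split_fun.
Proof.
exists (fun p : {ffun D -> J} * {ffun G -> J} =>
  [ffun q : join => match (q : D + G) return J with inl d => p.1 d | inr x => p.2 x end]).
- by move=> h; apply/ffunP=> -[d|x]; rewrite !ffunE /= ?ffunE.
- by case=> a b; congr pair; apply/ffunP=> x; rewrite !ffunE.
Qed.

Lemma is_hom_join (h : {ffun join -> J}) :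
  is_hom h = [&& is_hom (split_fun h).1, is_hom (split_fun h).2 &
     [forall d, forall x, c d x ==> adj ((split_fun h).1 d) ((split_fun h).2 x)]].
Proof.
apply/is_homP/and3P => [hh | [/is_homP h1 /is_homP h2 /forallP h3]].
  split; first by apply/is_homP=> d d' e; rewrite !ffunE; apply: hh.
    by apply/is_homP=> x y e; rewrite !ffunE; apply: hh.
  apply/forallP=> d; apply/forallP=> x; apply/implyP => e; rewrite !ffunE.
  exact: hh.
have h3' d x : c d x -> adj (h (inl d)) (h (inr x)).
  by move=> e; have /forallP/(_ x)/implyP/(_ e) := h3 d; rewrite !ffunE.
case=> [d|x] [d'|y] /= e.
- by have := h1 _ _ e; rewrite !ffunE.
- exact: h3'.
- by rewrite adj_sym; apply: h3'.
- by have := h2 _ _ e; rewrite !ffunE.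
Qed.

Lemma card_split_fun (B : {set {ffun D -> J} * {ffun G -> J}}) :
  #|split_fun @^-1: B| = #|B|.
Proof. exact: on_card_preimset (onW_bij _ split_fun_bij). Qed.

End Join.

Definition homr (F : graph) (r : F) (J : graph) (u : J) : nat :=
  #|[set h : {ffun F -> J} | is_hom h && (h r == u)]|.

Definition ghom (D : graph) (A : pred D) (J : graph) (u : J) : nat :=
  #|[set h : {ffun D -> J} | is_hom h && [forall d, A d ==> adj (h d) u]]|.

Definition glue (D : graph) (A : pred D) (G : graph) (v : G) : graph :=
  @join D G (fun d x => A d && (x == v)).

(** Sort the homomorphisms by the image [u] of [v]. All cross edges end in [v], so once [u] is fixed
    the restrictions to [D] and to [G] can be chosen independently. *)
Lemma hom_glue (D : graph) (A : pred D) (G : graph) (v : G) (J : graph) :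
  hom (glue A v) J = \sum_(u : J) ghom A u * homr v u.
Proof.
rewrite /hom -sum1_card (partition_big (fun h : {ffun glue A v -> J} => h (inr v)) predT) //=.
apply: eq_bigr => u _.
rewrite /ghom /homr -cardsX.
under eq_bigl => h do rewrite inE.
rewrite sum1dep_card -[RHS](@card_split_fun D G (fun d x => A d && (x == v)) J).
apply: eq_card => h; rewrite !inE is_hom_join !ffunE -!andbA; set b1 := is_hom _; set b2 := is_hom _.
case: b1 => //=; case: b2; rewrite /= ?andbF //.
case: eqP => [hv|]; rewrite ?andbF // !andbT.
apply/forallP/forallP => [hh d | hh d].
  apply/implyP => Ad; have /forallP/(_ v) := hh d; rewrite Ad eqxx /= !ffunE hv.
  by apply.
apply/forallP => x; apply/implyP => /andP[Ad /eqP->].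
by have := hh d; rewrite Ad !ffunE hv; apply.
Qed.

Definition dsum (D E : graph) : graph := @join D E (fun _ _ => false).

Definition dsum_pred (D E : graph) (A : pred D) (B : pred E) : pred (dsum D E) :=
  fun p => match (p : D + E) return bool with inl d => A d | inr e => B e end.

(** Without cross edges the two restrictions are independent, and the condition on the marks splits
    into one condition on each side. *)
Lemma ghom_dsum (D E : graph) (A : pred D) (B : pred E) (J : graph) (u : J) :
  ghom (dsum_pred A B) u = ghom A u * ghom B u.
Proof.
rewrite /ghom -cardsX -[RHS](@card_split_fun D E (fun _ _ => false) J).
apply: eq_card => h; rewrite !inE is_hom_join.
have -> : [forall d, forall x, false ==> adj ((split_fun h).1 d) ((split_fun h).2 x)].
  by apply/forallP=> d; apply/forallP.
rewrite andbT -!andbA; set b1 := is_hom _; set b2 := is_hom _.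
case: b1 => //=; case: b2; rewrite /= ?andbF //.
apply/forallP/andP => [hh | [/forallP h1 /forallP h2]].
  by split; apply/forallP => d; rewrite ffunE; [apply: (hh (inl d)) | apply: (hh (inr d))].
by case=> d /=; [have := h1 d | have := h2 d]; rewrite ffunE.
Qed.

Definition empty_graph : graph := @Graph void (fun _ _ => false) (fun _ _ => erefl).
Definition point_graph : graph := @Graph unit (fun _ _ => false) (fun _ _ => erefl).

Lemma ghom_empty (A : pred empty_graph) (J : graph) (u : J) : ghom A u = 1.
Proof.
rewrite /ghom (_ : [set _ | _] = [set: {ffun empty_graph -> J}]).
  by rewrite cardsT card_ffun card_void expn0.
apply/setP=> h; rewrite !inE; apply/andP; split; first by apply/is_homP; case.
by apply/forallP; case.
Qed.

(** The two conditions make every glued graph a legal oracle input. Connectedness is asked only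
    after adding a root, because products are disjoint unions. *)
Record gadget := Gadget {
  gadget_graph :> graph;
  gadget_pred : pred gadget_graph;
  gadget_irreflexive : irreflexive_graph gadget_graph;
  gadget_connected : connected (@glue gadget_graph gadget_pred point_graph tt)
}.

Lemma connect_adj_sym (G : graph) : connect_sym (@adj G).
Proof. exact/sym_connect_sym/adj_sym. Qed.

Lemma connected_to (G : graph) (x : G) :
  (forall y, connect (@adj G) y x) -> connected G.
Proof.
by move=> cx y z; apply: connect_trans (cx y) _; rewrite connect_adj_sym.
Qed.

Lemma glue_connected (X : gadget) (G : graph) (v : G) :
  connected G -> connected (glue (@gadget_pred X) v).
Proof.
move=> cG; apply: (connected_to (x := inr v : glue _ _)) => -[d|x].
  pose f (p : glue (@gadget_pred X) (tt : point_graph)) : glue (@gadget_pred X) v :=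
    match (p : X + unit) return (_ + _)%type with inl d => inl d | inr _ => inr v end.
  have hf : {homo f : x y / adj x y}.
    by case=> [d1|[]] [d2|[]] //=; rewrite eqxx andbT => ->; rewrite eqxx.
  exact: (homo_connect hf (gadget_connected (inl d) (inr tt))).
have hf : {homo (fun y : G => inr y : glue (@gadget_pred X) v) : x y / adj x y} by [].
exact: (homo_connect hf (cG x v)).
Qed.

Lemma glue_irreflexive (X : gadget) (G : graph) (v : G) :
  irreflexive_graph G -> irreflexive_graph (glue (@gadget_pred X) v).
Proof. by move=> iG [d|x] /=; [apply: gadget_irreflexive | apply: iG]. Qed.

Lemma dsum_irreflexive (D E : graph) :
  irreflexive_graph D -> irreflexive_graph E -> irreflexive_graph (dsum D E).
Proof. by move=> iD iE [d|e] /=; [apply: iD | apply: iE]. Qed.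

Lemma dsum_gadget_connected (X Y : gadget) :
  connected (@glue (dsum X Y) (dsum_pred (@gadget_pred X) (@gadget_pred Y)) point_graph tt).
Proof.
apply: (connected_to (x := inr tt : glue _ (tt : point_graph))) => -[[d|e]|[]] //.
- pose f (p : glue (@gadget_pred X) (tt : point_graph)) :
    @glue (dsum X Y) (dsum_pred (@gadget_pred X) (@gadget_pred Y)) point_graph tt :=
    match (p : X + unit) return (_ + _)%type with inl d => inl (inl d) | inr _ => inr tt end.
  have hf : {homo f : x y / adj x y} by case=> [d1|[]] [d2|[]].
  exact: (homo_connect hf (gadget_connected (inl d) (inr tt))).
- pose f (p : glue (@gadget_pred Y) (tt : point_graph)) :
    @glue (dsum X Y) (dsum_pred (@gadget_pred X) (@gadget_pred Y)) point_graph tt :=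
    match (p : Y + unit) return (_ + _)%type with inl d => inl (inr d) | inr _ => inr tt end.
  have hf : {homo f : x y / adj x y} by case=> [d1|[]] [d2|[]].
  exact: (homo_connect hf (gadget_connected (inl e) (inr tt))).
Qed.

Definition gadget_mul (X Y : gadget) : gadget :=
  Gadget (dsum_irreflexive (@gadget_irreflexive X) (@gadget_irreflexive Y))
    (@dsum_gadget_connected X Y).

Lemma empty_gadget_connected : connected (@glue empty_graph xpredT point_graph tt).
Proof. by apply: (connected_to (x := inr tt : glue _ (tt : point_graph))) => -[[]|[]]. Qed.

(** Its value is 1 at every pair, which puts the constants into the span. *)
Definition gadget_one : gadget :=
  @Gadget empty_graph xpredT (fun x => erefl) empty_gadget_connected.

Definition gval (X : gadget) (J : graph) (u : J) : nat := ghom (@gadget_pred X) u.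

Section RootedGadget.
Variables (F : graph) (r : F) (cF : connected F) (iF : irreflexive_graph F).

Definition unrooted : graph :=
  @Graph {x : F | x != r} (fun x y => adj (val x) (val y))
    (fun x y => adj_sym (val x) (val y)).

Definition root_nbr : pred unrooted := fun x => adj (val x) r.

Definition unroot (x : F) : glue root_nbr (tt : point_graph) :=
  if insub x is Some d then inl d else inr tt.

Lemma unroot_homo : {homo unroot : x y / adj x y}.
Proof.
move=> x y; rewrite /unroot.
case: insubP => [d _ <-|/negPn/eqP->]; case: insubP => [d' _ <-|/negPn/eqP->] //=.
- by rewrite /root_nbr eqxx => ->.
- by rewrite /root_nbr eqxx adj_sym => ->.
- by rewrite iF.
Qed.

Lemma unroot_surj p : exists x, unroot x = p.
Proof.
case: p => [d|[]].
  by exists (val d); rewrite /unroot valK.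
by exists r; rewrite /unroot insubF ?eqxx.
Qed.

Definition rooted_gadget : gadget :=
  @Gadget unrooted root_nbr (fun x => iF (val x))
    (connected_image unroot_homo unroot_surj cF).

(** Restriction to the vertices other than [r] is inverse to extension by [u] at [r]. The marks
    record the edges at [r], and [iF] excludes a loop there. *)
Lemma gval_rooted (J : graph) (u : J) : gval rooted_gadget u = homr r u.
Proof.
rewrite /gval /ghom /homr /=.
pose ext (h : {ffun unrooted -> J}) : {ffun F -> J} :=
  [ffun x => if insub x is Some d then h d else u].
pose res (h : {ffun F -> J}) : {ffun unrooted -> J} := [ffun d => h (val d)].
have extv h d : ext h (val d) = h d by rewrite ffunE valK.
have extr h : ext h r = u by rewrite ffunE insubF ?eqxx.
apply: (@eq_card_cancel _ _ _ _ ext res).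
- move=> h; rewrite !inE => /andP[/is_homP hh /forallP hr]; rewrite extr eqxx andbT.
  apply/is_homP=> x y; rewrite !ffunE.
  case: insubP => [d _ <-|/negPn/eqP->]; case: insubP => [d' _ <-|/negPn/eqP->] //=.
  + exact: hh.
  + by move=> e; have := hr d; rewrite /root_nbr e.
  + by rewrite adj_sym => e; have := hr d'; rewrite /root_nbr e adj_sym.
  + by rewrite iF.
- move=> h; rewrite !inE => /andP[/is_homP hh /eqP hr]; apply/andP; split.
    by apply/is_homP=> x y e; rewrite !ffunE; apply: hh.
  apply/forallP => d; apply/implyP => e; rewrite ffunE -hr; exact: hh.
- by move=> h _; apply/ffunP=> d; rewrite ffunE extv.
- move=> h; rewrite inE => /andP[_ /eqP hr]; apply/ffunP => x; rewrite ffunE.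
  by case: insubP => [d _ <-|/negPn/eqP->]; rewrite ?ffunE.
Qed.

End RootedGadget.

(** * Rooted homomorphism counts determine a connected graph *)

Section Quotient.
Variables (F : graph) (X : finType) (k : F -> X).

(** The classes of the kernel of [k] are represented by the values of [k]. A class containing an
    edge gets a loop, which is why Lovász's argument below allows loops in its test graphs. *)
Definition quotient_adj (a b : {y : X | y \in codom k}) : bool :=
  [exists x, exists y, [&& k x == val a, k y == val b & adj x y]].

Lemma quotient_adj_sym : symmetric quotient_adj.
Proof.
move=> a b; apply/existsP/existsP => -[x /existsP[y /and3P[ex ey e]]];
  by exists y; apply/existsP; exists x; rewrite ex ey adj_sym.
Qed.

Definition quotient_graph : graph := Graph quotient_adj_sym.

Definition quotient_map (x : F) : quotient_graph := Sub (k x) (codom_f k x).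

Lemma quotient_map_homo : {homo quotient_map : x y / adj x y}.
Proof.
by move=> x y e; apply/existsP; exists x; apply/existsP; exists y; rewrite /= !eqxx.
Qed.

Lemma quotient_map_eq x y : (quotient_map x == quotient_map y) = (k x == k y).
Proof. by rewrite -val_eqE. Qed.

Definition quotient_rep (a : quotient_graph) : F := iinv (valP a).

Lemma quotient_repK : cancel quotient_rep quotient_map.
Proof. by move=> a; apply/val_inj; rewrite /= f_iinv. Qed.

Lemma quotient_connected : connected F -> connected quotient_graph.
Proof.
apply: (connected_image quotient_map_homo) => a.
by exists (quotient_rep a); rewrite quotient_repK.
Qed.

Lemma card_quotient : ~~ injectiveb k -> #|quotient_graph| < #|F|.
Proof.
move=> ninj; rewrite card_sig ltn_neqAle leq_image_card andbT.
apply: contra ninj => /eqP e; apply/injectiveP.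
by apply: in2T; apply/image_injP; rewrite -[X in _ == X]e; apply/eqP/eq_card => y.
Qed.

End Quotient.

(** As a set of pairs of vertices, the kernel has a finite type independent of the codomain and can
    index a sum. *)
Definition kernel (F X : finType) (h : F -> X) : {set F * F} :=
  [set p | h p.1 == h p.2].

Lemma kernelP (F X Y : finType) (h : F -> X) (k : F -> Y) :
  kernel h = kernel k -> forall x y, (h x == h y) = (k x == k y).
Proof. by move/setP=> e x y; have := e (x, y); rewrite !inE. Qed.

Lemma kernel_injective (F X : finType) (h : F -> X) :
  injectiveb h = (kernel h == kernel (@id F)).
Proof.
apply/injectiveP/eqP => [inj | e x y /eqP].
  by apply/setP=> -[x y]; rewrite !inE /= (inj_eq inj).
by rewrite (kernelP e) => /eqP.
Qed.

Definition injr (F : graph) (r : F) (J : graph) (u : J) : nat :=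
  #|[set h : {ffun F -> J} | [&& is_hom h, h r == u & injectiveb h]]|.

(** A homomorphism with the same kernel as [k] factors uniquely through the quotient by [k], and the
    induced map is injective. *)
Lemma card_hom_kernel (F : graph) (r : F) (X : finType) (k : F -> X) (J : graph) (u : J) :
  #|[set h : {ffun F -> J} | [&& is_hom h, h r == u & kernel h == kernel k]]|
    = injr (quotient_map k r) u.
Proof.
pose lift_ (g : {ffun quotient_graph k -> J}) : {ffun F -> J} :=
  [ffun x => g (quotient_map k x)].
pose desc (h : {ffun F -> J}) : {ffun quotient_graph k -> J} :=
  [ffun a => h (quotient_rep a)].
have descE (h : {ffun F -> J}) x : kernel h = kernel k ->
    desc h (quotient_map k x) = h x.
  move=> e; rewrite ffunE; apply/eqP; rewrite (kernelP e) -quotient_map_eq.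
  by rewrite quotient_repK.
apply: (@eq_card_cancel _ _ _ _ desc lift_).
- move=> h; rewrite !inE => /and3P[/is_homP hh /eqP hr /eqP e].
  rewrite descE // hr eqxx /=; apply/andP; split.
    apply/is_homP => a b /existsP[x /existsP[y /and3P[/eqP xa /eqP yb exy]]].
    have -> : a = quotient_map k x by apply/val_inj.
    have -> : b = quotient_map k y by apply/val_inj.
    by rewrite !descE //; apply: hh.
  apply/injectiveP => a b; rewrite !ffunE => /eqP; rewrite (kernelP e) -quotient_map_eq.
  by rewrite !quotient_repK => /eqP.
- move=> g; rewrite !inE => /and3P[/is_homP hg /eqP gr /injectiveP inj].
  rewrite ffunE gr eqxx /=; apply/andP; split.
    by apply/is_homP=> x y e; rewrite !ffunE; apply/hg/quotient_map_homo.
  apply/eqP/setP=> -[x y]; rewrite !inE /= !ffunE (inj_eq inj).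
  exact: quotient_map_eq.
- by move=> h; rewrite inE => /and3P[_ _ /eqP e]; apply/ffunP=> x; rewrite ffunE descE.
- by move=> g _; apply/ffunP=> a; rewrite !ffunE quotient_repK.
Qed.

Lemma homr_kernels (F : graph) (r : F) (J : graph) (u : J) :
  homr r u = \sum_(S : {set F * F})
    #|[set h : {ffun F -> J} | [&& is_hom h, h r == u & kernel h == S]]|.
Proof.
rewrite /homr -sum1_card (partition_big (fun h : {ffun F -> J} => kernel h) predT) //=.
apply: eq_bigr => S _; rewrite -sum1dep_card; apply: eq_bigl => h.
by rewrite inE andbA.
Qed.

Section Lovasz.
Variables (J K : graph) (u : J) (w : K).
Hypothesis eq_homr : forall (F : graph) (r : F), connected F -> homr r u = homr r w.

(** Induction on the number of vertices. Split [homr] by kernels: the trivial kernel contributes the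
    injective count, any other one the injective count of a strictly smaller quotient. *)
Lemma eq_injr (F : graph) (r : F) : connected F -> injr r u = injr r w.
Proof.
move: {2}#|F|.+1 (ltnSn #|F|) => n; elim: n => // n IHn in F r * => ltFn cF.
have := eq_homr r cF.
have injrE (L : graph) (z : L) : injr r z =
    #|[set h : {ffun F -> L} | [&& is_hom h, h r == z & kernel h == kernel (@id F)]]|.
  by apply: eq_card => h; rewrite !inE kernel_injective.
rewrite !homr_kernels !injrE [LHS](bigD1 (kernel (@id F))) //.
rewrite [RHS](bigD1 (kernel (@id F))) //=.
rewrite (eq_bigr (fun S => #|[set h : {ffun F -> K} |
   [&& is_hom h, h r == w & kernel h == S]]|)); first exact: addIn.
move=> S nS.
have quo (X : finType) (k : F -> X) : kernel k = S ->
    #|[set h : {ffun F -> J} | [&& is_hom h, h r == u & kernel h == S]]| =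
    #|[set h : {ffun F -> K} | [&& is_hom h, h r == w & kernel h == S]]|.
  move=> kS; rewrite -kS !card_hom_kernel; apply: IHn; last exact: quotient_connected.
  by apply: leq_trans (card_quotient _) ltFn; rewrite kernel_injective kS.
(* If some homomorphism to [J] or to [K] has kernel [S], it serves as [k]; otherwise both counts are
   0. *)
have [J0|[h]] := set_0Vmem [set h : {ffun F -> J} | [&& is_hom h, h r == u & kernel h == S]].
  have [->|[h]] := set_0Vmem [set h : {ffun F -> K} | [&& is_hom h, h r == w & kernel h == S]].
    by rewrite J0 !cards0.
  by rewrite inE => /and3P[_ _ /eqP/quo].
by rewrite inE => /and3P[_ _ /eqP/quo].
Qed.

End Lovasz.

Lemma injr_self (J : graph) (u : J) : 0 < injr u u.
Proof.
apply/card_gt0P; exists [ffun x => x]; rewrite inE ffunE eqxx /=; apply/andP; split.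
  by apply/is_homP=> x y; rewrite !ffunE.
by apply/injectiveP=> x y; rewrite !ffunE.
Qed.

Definition edges (J : graph) : {set J * J} := [set p | adj p.1 p.2].

Lemma injr_homo (J K : graph) (u : J) (w : K) : 0 < injr u w ->
  exists2 f : J -> K, injective f & {homo f : x y / adj x y}.
Proof.
by case/card_gt0P=> f; rewrite inE => /and3P[/is_homP hf _ /injectiveP inj]; exists f.
Qed.

Lemma leq_edges (J K : graph) (f : J -> K) :
  injective f -> {homo f : x y / adj x y} -> #|edges J| <= #|edges K|.
Proof.
move=> inj hf; pose g (p : J * J) := (f p.1, f p.2).
have injg : injective g by case=> a b [c d] [/inj-> /inj->].
rewrite -(card_imset _ injg); apply/subset_leq_card/subsetP => _ /imsetP[p pE ->].
by move: pE; rewrite !inE; apply: hf.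
Qed.

(** Because of [g], [K] has at most as many edges as [J], so the injection that [f] induces on edges
    is onto; hence [f] also reflects adjacency. *)
Lemma isomorphic_of_injective (J K : graph) (f : J -> K) (g : K -> J) :
  injective f -> {homo f : x y / adj x y} ->
  injective g -> {homo g : x y / adj x y} -> isomorphic J K.
Proof.
move=> injf hf injg hg; exists f.
  by apply: inj_card_bij => //; apply: leq_card injg.
move=> x y; apply/idP/idP; last exact: hf.
pose ff (p : J * J) := (f p.1, f p.2).
have injff : injective ff by case=> a b [c d] [/injf-> /injf->].
have sub : ff @: edges J \subset edges K.
  by apply/subsetP => _ /imsetP[p pE ->]; move: pE; rewrite !inE; apply: hf.
have /eqP e : ff @: edges J == edges K.
  by rewrite eqEcard sub card_imset // (leq_edges injg hg).
move=> exy; have : (f x, f y) \in edges K by rewrite inE.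
by rewrite -e => /imsetP[[a b] abE [/injf-> /injf->]]; move: abE; rewrite inE.
Qed.

(** Test with [J] and [K] themselves: the identity makes the injective count positive on one side,
    hence on the other, which gives injective homomorphisms in both directions. *)
Lemma isomorphic_of_homr (J K : graph) (u : J) (w : K) :
  connected J -> connected K ->
  (forall (F : graph) (r : F), connected F -> homr r u = homr r w) ->
  isomorphic J K.
Proof.
move=> cJ cK e.
have [f injf hf] : exists2 f : J -> K, injective f & {homo f : x y / adj x y}.
  by apply: (@injr_homo _ _ u w); rewrite -(eq_injr e) ?injr_self.
have [g injg hg] : exists2 g : K -> J, injective g & {homo g : x y / adj x y}.
  by apply: (@injr_homo _ _ w u); rewrite (eq_injr e) ?injr_self.
exact: isomorphic_of_injective injf hf injg hg.
Qed.

Definition loopless (F : graph) : graph :=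
  @Graph F (fun x y => (x != y) && adj x y)
    (fun x y => congr2 andb (congr1 negb (eq_sym x y)) (adj_sym x y)).

Lemma loopless_connected (F : graph) : connected F -> connected (loopless F).
Proof.
move=> cF x y; apply: connect_sub (cF x y) => {x y} x y e.
have [->|nxy] := eqVneq x y; first exact: connect0.
by apply: connect1; rewrite /= nxy.
Qed.

Lemma homr_loopless (F : graph) (r : F) (J : graph) (u : J) :
  reflexive_graph J -> homr r u = @homr (loopless F) r J u.
Proof.
move=> rJ; apply: eq_card => h; rewrite !inE; congr andb.
apply/is_homP/is_homP => hh x y; first by case/andP=> _; apply: hh.
by have [->|nxy] := eqVneq x y; [move=> _; apply: rJ | move=> e; apply: hh; rewrite /= nxy].
Qed.

Lemma homr_loop (F : graph) (r x : F) (J : graph) (u : J) :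
  irreflexive_graph J -> adj x x -> homr r u = 0.
Proof.
move=> iJ e; apply/eqP; rewrite cards_eq0; apply/eqP/setP => h; rewrite !inE.
by apply/negP=> /andP[/is_homP/(_ _ _ e)]; rewrite iJ.
Qed.

(** Gadgets supply irreflexive test graphs only. An arbitrary [F] loses its loops if the targets are
    reflexive; if they are irreflexive, a loop in [F] makes both counts 0. *)
Lemma gadgets_separate (J K : graph) (u : J) (w : K) :
  connected J -> connected K ->
  (reflexive_graph J /\ reflexive_graph K) \/
    (irreflexive_graph J /\ irreflexive_graph K) ->
  (forall X : gadget, gval X u = gval X w) -> isomorphic J K.
Proof.
move=> cJ cK rJK e.
have eI (F : graph) (r : F) : connected F -> irreflexive_graph F -> homr r u = homr r w.
  by move=> cF iF; rewrite -!(gval_rooted r cF iF).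
apply: (isomorphic_of_homr (u := u) (w := w)) => // F r cF.
case: rJK => -[rJ rK].
  rewrite (homr_loopless r u rJ) (homr_loopless r w rK); apply: eI; first exact: loopless_connected.
  by move=> x /=; rewrite eqxx.
have [/existsP[x exx]|/existsPn nl] := boolP [exists x : F, adj x x].
  by rewrite !(homr_loop _ _ _ exx).
by apply: eI => // x; apply/negbTE/nl.
Qed.

(** * Interpolation *)

Section Interpolation.
Variable W : weighted_graph_set.
Hypothesis cases :
  (forall J : wgs_index W, reflexive_graph (wgs_graph J)) \/
  (forall J : wgs_index W,
     irreflexive_graph (wgs_graph J) /\ bipartite (wgs_graph J)).
Local Open Scope ring_scope.

Let point := {i : wgs_index W & wgs_graph i}.

Definition pval (X : gadget) (p : point) : int := (gval X (tagged p))%:Z.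

(** The integer span of the gadget values as functions on the pairs (graph, vertex). By [gspanM] and
    [gspan_const] it is a ring. *)
Definition gspan (phi : point -> int) : Prop :=
  exists s : seq (int * gadget), forall p, phi p = \sum_(x <- s) x.1 * pval x.2 p.

Lemma gspan_ext (phi psi : point -> int) : phi =1 psi -> gspan phi -> gspan psi.
Proof. by move=> e [s hs]; exists s => p; rewrite -e. Qed.

Lemma gspan_gadget X : gspan (pval X).
Proof. by exists [:: (1, X)] => p; rewrite big_seq1 mul1r. Qed.

Lemma gspan_const (c : int) : gspan (fun _ => c).
Proof.
exists [:: (c, gadget_one)] => p.
by rewrite big_seq1 /pval /gval /= ghom_empty mulr1.
Qed.

Lemma gspanD phi psi : gspan phi -> gspan psi -> gspan (fun p => phi p + psi p).
Proof. by move=> [s hs] [t ht]; exists (s ++ t) => p; rewrite big_cat /= hs ht. Qed.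

Lemma pval_mul X Y p : pval (gadget_mul X Y) p = pval X p * pval Y p.
Proof. by rewrite /pval /gval -PoszM; congr Posz; apply: ghom_dsum. Qed.

Lemma gspanM phi psi : gspan phi -> gspan psi -> gspan (fun p => phi p * psi p).
Proof.
move=> [s hs] [t ht].
exists [seq (x.1 * y.1, gadget_mul x.2 y.2) | x <- s, y <- t] => p.
rewrite hs ht big_distrl big_allpairs_dep /=; apply: eq_bigr => x _.
rewrite big_distrr /=; apply: eq_bigr => y _.
by rewrite pval_mul; ring.
Qed.

Lemma gspanB phi psi : gspan phi -> gspan psi -> gspan (fun p => phi p - psi p).
Proof.
move=> hphi hpsi; apply: gspanD hphi _.
by apply: gspan_ext (gspanM (gspan_const (-1)) hpsi) => p; rewrite mulN1r.
Qed.

Lemma gspan_prod (I : Type) (r : seq I) (P : pred I) (phi : I -> point -> int) :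
  (forall i, P i -> gspan (phi i)) -> gspan (fun p => \prod_(i <- r | P i) phi i p).
Proof.
move=> h; elim: r => [|i r IHr].
  by apply: gspan_ext (gspan_const 1) => p; rewrite big_nil.
have [Pi|nPi] := boolP (P i); last first.
  by apply: gspan_ext IHr => p; rewrite big_cons (negbTE nPi).
by apply: gspan_ext (gspanM (h i Pi) IHr) => p; rewrite big_cons Pi.
Qed.

Lemma point_separation (p q : point) : tag p != tag q ->
  exists2 phi, gspan phi & phi p != 0 /\ phi q = 0.
Proof.
move=> npq.
have [X nX] : exists X, gval X (tagged p) <> gval X (tagged q).
  apply: NNPP => nX; case/eqP: npq; apply: (@wgs_inj W).
  apply: (gadgets_separate (u := tagged p) (w := tagged q)).
  - exact: wgs_connected.
  - exact: wgs_connected.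
  - by case: cases => c; [left | right]; split; apply c.
  - by move=> X; apply: NNPP => e; apply: nX; exists X.
exists (fun x => pval X x - pval X q).
  exact: gspanB (gspan_gadget X) (gspan_const _).
by split; [rewrite subr_eq0; apply/eqP => -[] | rewrite subrr].
Qed.

(** Multiply, over all pairs [q] outside [H], functions that vanish at [q] but not at [p]; the
    product is nonzero at [p] because the integers form a domain. *)
Lemma point_isolation (H : wgs_index W) (p : point) : tag p = H ->
  exists2 phi, gspan phi & phi p != 0 /\ forall q, tag q != H -> phi q = 0.
Proof.
move=> pH.
have [phi hphi] : exists phi : point -> point -> int,
    forall q, tag q != H -> [/\ gspan (phi q), phi q p != 0 & phi q q = 0].
  suff: forall q, exists f : {ffun point -> int},
      tag q != H -> [/\ gspan f, f p != 0 & f q = 0].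
    by case/fin_all_exists => f hf; exists (fun q => f q).
  move=> q; have [qH|nq] := eqVneq (tag q) H; first by exists [ffun=> 0] => /eqP.
  have [|f fs [fp fq]] := @point_separation p q; first by rewrite pH eq_sym.
  exists [ffun x => f x] => _; split; rewrite ?ffunE //.
  by apply: gspan_ext fs => x; rewrite ffunE.
exists (fun x => \prod_(q | tag q != H) phi q x).
  by apply: gspan_prod => q /hphi[].
split; first by apply/prodf_neq0 => q /hphi[].
by move=> q nq; rewrite (bigD1 q) //=; have [_ _ ->] := hphi q nq; rewrite mul0r.
Qed.

Lemma indicator_gspan (H : wgs_index W) :
  exists2 c : int, c != 0 & gspan (fun p => c * (tag p == H)%:R).
Proof.
have [phi hphi] : exists phi : point -> {ffun point -> int},
    forall p, tag p = H ->
      [/\ gspan (phi p), phi p p != 0 & forall q, tag q != H -> phi p q = 0].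
  suff: forall p : point, exists f : {ffun point -> int}, tag p = H ->
      [/\ gspan f, f p != 0 & forall q, tag q != H -> f q = 0].
    exact: fin_all_exists.
  move=> p; have [pH|/eqP nq] := eqVneq (tag p) H; last by exists [ffun=> 0].
  have [f fs [fp fq]] := point_isolation pH.
  exists [ffun x => f x] => _; split; rewrite ?ffunE //.
    by apply: gspan_ext fs => x; rewrite ffunE.
  by move=> q nq; rewrite ffunE fq.
pose c := \prod_(p | tag p == H) phi p p.
exists c; first by apply/prodf_neq0 => p /eqP/hphi[].
(* The function sought is [c] minus this product. At a pair of [H] one factor vanishes, which leaves
   [c]; elsewhere every [phi p x] is 0, so the product equals [c]. *)
suff sp : gspan (fun x => \prod_(p : point | tag p == H) (phi p p - phi p x)).
  apply: gspan_ext (gspanB (gspan_const c) sp) => x.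
  have [xH|nx] := eqVneq (tag x) H.
    by rewrite (bigD1 x) ?xH //= subrr mul0r subr0 mulr1.
  rewrite mulr0 /c; apply/eqP; rewrite subr_eq0; apply/eqP/eq_bigr => p /eqP/hphi[_ _ hp].
  by rewrite (hp x nx) subr0.
by apply: gspan_prod => p /eqP/hphi[sp _ _]; apply: gspanB (gspan_const _) sp.
Qed.

Lemma interpolation (H : wgs_index W) : wgs_weight H <> 0 ->
  exists (K : nat) (m : 'I_K -> int) (X : 'I_K -> gadget) (d : nat), (0 < d)%N /\
    forall (i : wgs_index W) (u : wgs_graph i),
      wgs_weight i * (\sum_a m a * (gval (X a) u)%:Z) = d%:Z * (i == H)%:R.
Proof.
move=> /eqP nz; have [c c0 cs] := indicator_gspan H.
pose d := wgs_weight H * c.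
(* The sign of [d] goes into the coefficients, so that the divisor becomes the positive number
   [|d|]. *)
have [s hs] := gspanM (gspan_const (Num.sg d)) cs.
pose x a := nth (0, gadget_one) s a.
exists (size s), (fun a => (x a).1), (fun a => (x a).2), `|d|%N; split; first by rewrite absz_gt0 mulf_neq0.
move=> i u; have := hs (Tagged (fun i => wgs_graph i) u); rewrite /pval (big_nth (0, gadget_one)) big_mkord /= => <-.
have [->|_] := eqVneq i H; last by rewrite !mulr0.
by rewrite mulrCA (mulrA (wgs_weight H)) -/d mulrA -normrEsg abszE.
Qed.

Definition glue_instance (X : gadget) (G : connected_irreflexive_graph) (v : G) :
    connected_irreflexive_graph :=
  ConnectedIrreflexiveGraph (@glue_connected X G v (@cig_connected G))
    (@glue_irreflexive X G v (@cig_irreflexive G)).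

Lemma Posz_sum (I : finType) (F : I -> nat) :
  Posz (\sum_i F i)%N = \sum_i (F i)%:Z.
Proof. exact: (big_morph Posz PoszD). Qed.

Lemma hom_sum_roots (G : graph) (v : G) (J : graph) :
  hom G J = (\sum_(u : J) homr v u)%N.
Proof.
rewrite /hom -sum1_card (partition_big (fun h : {ffun G -> J} => h v) predT) //=.
by apply: eq_bigr => u _; rewrite /homr -sum1dep_card; apply: eq_bigl => h; rewrite inE.
Qed.

(** The glued graph contains [v], so the special value for the empty graph does not occur. *)
Lemma GSHomC_glue (X : gadget) (G : connected_irreflexive_graph) (v : G) :
  @output (GSHomC W) (glue_instance X v) =
  \sum_(i : wgs_index W) wgs_weight i * (hom (glue (@gadget_pred X) v) (wgs_graph i))%:Z.
Proof.
rewrite /= ifF //; apply/negbTE; rewrite -lt0n; apply/card_gt0P.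
by exists (inr v).
Qed.

(** Expand each glued count over the image of the root and exchange the sums. The inner combination
    is then the one of [interpolation], which kills every graph except [H] and is the same for all
    its roots. *)
Lemma hom_interpolation (H : wgs_index W) : wgs_weight H <> 0 ->
  exists (K : nat) (m : 'I_K -> int) (X : 'I_K -> gadget) (d : nat), (0 < d)%N /\
    forall (G : connected_irreflexive_graph) (v : G),
      \sum_a m a * @output (GSHomC W) (glue_instance (X a) v) =
      d%:Z * (hom G (wgs_graph H))%:Z.
Proof.
move=> nz; have [K [m [X [d [d_gt0 hs]]]]] := interpolation nz.
exists K, m, X, d; split=> // G v.
under eq_bigr => a _ do rewrite GSHomC_glue mulr_sumr.
rewrite exchange_big /=.
have step i : \sum_a m a *
      (wgs_weight i * (hom (glue (@gadget_pred (X a)) v) (wgs_graph i))%:Z) =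
    d%:Z * (i == H)%:R * (hom G (wgs_graph i))%:Z.
  under eq_bigr => a _ do rewrite hom_glue Posz_sum !mulr_sumr.
  rewrite exchange_big (hom_sum_roots v) Posz_sum mulr_sumr /=.
  apply: eq_bigr => u _; rewrite -(hs i u) mulr_sumr mulr_suml.
  by apply: eq_bigr => a _; rewrite PoszM /gval; ring.
under eq_bigr => i _ do rewrite step.
rewrite (bigD1 H) //= eqxx mulr1 big1 ?addr0 // => i /negbTE->.
by rewrite mulr0 mul0r.
Qed.

End Interpolation.

(** * Binary numbers *)

Definition bval (s : bitstring) : nat := foldr (fun (b : bool) v => b + v.*2) 0 s.

Lemma code_natE (n : nat) : 0 < n -> code_nat n = odd n :: code_nat n./2.
Proof.
move=> n_gt0; rewrite /code_nat /mkseq up_log2S //= expn0 divn1; congr cons.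
rewrite -[1]addn0 iotaDl -map_comp; apply: eq_map => i /=.
by rewrite expnS divnMA divn2.
Qed.

Lemma bval_code_nat (n : nat) : bval (code_nat n) = n.
Proof.
elim/ltn_ind: n => -[|n] // IHn; rewrite code_natE // -[RHS]odd_double_half -[in RHS](IHn n.+1./2) //.
by rewrite -divn2 ltn_Pdiv.
Qed.

Lemma bval_cat_false s z : bval (s ++ nseq z false) = bval s.
Proof. by elim: s => [|b s /= ->] //; elim: z => //= z ->. Qed.

Lemma code_nat_bval (s : bitstring) : (s == [::]) || last false s -> code_nat (bval s) = s.
Proof.
elim: s => [|b s IHs] //= hs.
have gt0 : 0 < b + (bval s).*2.
  case: b hs => //; elim: (s) => [|c u IHu] //= hu.
  by case: c hu => // /IHu; rewrite !double_gt0.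
rewrite code_natE // oddD odd_double addbF oddb; congr cons.
have -> : (b + (bval s).*2)./2 = bval s by rewrite half_bit_double.
by apply: IHs; case: (s) hs.
Qed.

(** With the least significant bit first, a factor [2 ^ k] shows as [k] initial zeros; for [n = 0]
    the code is empty and nothing is dropped. *)
Lemma drop_code_nat k (n : nat) : drop k (code_nat (2 ^ k * n)) = code_nat n.
Proof.
elim: k => [|k IHk]; first by rewrite mul1n drop0.
have [->|n_gt0] := posnP n; first by rewrite muln0.
rewrite code_natE /=; last by rewrite muln_gt0 expn_gt0.
by rewrite expnS -mulnA mul2n doubleK.
Qed.

Lemma strip_zeros (s : bitstring) :
  exists2 u : bitstring, (u == [::]) || last false u & exists z, s = u ++ nseq z false.
Proof.
elim/last_ind: s => [|s b [u hu [z ->]]]; first by exists [::] => //; exists 0.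
case: b; last by exists u => //; exists z.+1; rewrite -cats1 -catA -(nseqD z 1) addn1.
exists (rcons (u ++ nseq z false) true); first by rewrite last_rcons orbT.
by exists 0; rewrite cats0.
Qed.

Lemma size_code_nat (n e : nat) : n < 2 ^ e -> size (code_nat n) <= e.
Proof. by move=> h; rewrite size_mkseq; apply: up_log_min. Qed.

(** * Programs for oracle machines *)

(* Equality up to the trailing blanks of the two lists of cells. *)
Definition eqt (t t' : tape) : Prop :=
  [/\ scanned t = scanned t', nth None (to_left t) =1 nth None (to_left t')
    & nth None (to_right t) =1 nth None (to_right t')].

Lemma eqt_trans t1 t2 t3 : eqt t1 t2 -> eqt t2 t3 -> eqt t1 t3.
Proof. by case=> s l r [s' l' r']; split=> [|i|i]; rewrite ?s ?l ?r. Qed.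

Lemma eqt_write x t t' : eqt t t' -> eqt (write x t) (write x t').
Proof. by case=> s l r; split. Qed.

Lemma eqt_move d t t' : eqt t t' -> eqt (move_head d t) (move_head d t').
Proof.
case=> s l r; case: d; split => //=; rewrite -?nth0 ?s ?l ?r //.
- by move=> i; rewrite !nth_behead l.
- by case.
- by case.
- by move=> i; rewrite !nth_behead r.
Qed.

Lemma string_on_eqt t t' : eqt t t' -> string_on t = string_on t'.
Proof.
case=> s _ r; rewrite /string_on s; case: (scanned t') => //= b; congr cons.
elim: (to_right t) (to_right t') r => [|[c|] u IHu] [|[c'|] u'] //= r.
- by have := r 0.
- by have := r 0.
- by have [->] := r 0; congr cons; apply: IHu => i; have := r i.+1.
- by have := r 0.
- by have := r 0.
Qed.

(* The scanned cell is the first one of [s]. *)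
Definition cur (l s : seq symbol) : tape := Tape l (head None s) (behead s).

Lemma move_left_cur l s : eqt (move_head Left (cur l s)) (cur (behead l) (head None l :: s)).
Proof. by split=> //=; case: s => // -[|i] //=; rewrite nth_nil. Qed.

Lemma eqt_cur l l' s s' : nth None l =1 nth None l' -> nth None s =1 nth None s' ->
  eqt (cur l s) (cur l' s').
Proof. by move=> el es; split=> [|//|i] /=; rewrite -?nth0 ?es // !nth_behead es. Qed.

Lemma cur_blanks l k s : eqt (cur (l ++ nseq k None) s) (cur l s).
Proof.
apply: eqt_cur => // i; rewrite nth_cat nth_nseq if_same.
by case: ltnP => // h; rewrite nth_default.
Qed.

Lemma tape_of_cur w : tape_of w = cur [::] (map Some w).
Proof. by case: w. Qed.

(** [None] keeps the scanned symbol, so a command can be given without knowing that symbol. *)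
Definition cmd := (option symbol * direction)%type.

Definition apply_cmd (c : cmd) (t : tape) : tape :=
  move_head c.2 (if c.1 is Some x then write x t else t).

Definition cmd_act (s : symbol) (c : cmd) : symbol * direction := (odflt s c.1, c.2).

Lemma cmd_actE c t :
  move_head (cmd_act (scanned t) c).2 (write (cmd_act (scanned t) c).1 t) = apply_cmd c t.
Proof. by case: c => -[x|] d //; case: t. Qed.

Definition keep : cmd := (None, Stay).
Definition go (d : direction) : cmd := (None, d).
Definition put (x : symbol) (d : direction) : cmd := (Some x, d).

Section Programs.
Variables (K : nat) (f : bitstring -> bitstring).

Local Notation idx := 'I_K.+3.
Local Notation tapes := {ffun idx -> tape}.
Local Notation symbols := {ffun idx -> symbol}.

Record prog := Prog {
  pstate : finType;
  pstart : pstate;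
  pact : pstate -> action K.+3 pstate
}.

Definition machine (p : prog) : oracle_machine :=
  @OracleMachine K.+1 (pstate p) (pstart p) (@pact p).

Definition i0 : idx := ord0.
Definition i1 : idx := lift ord0 ord0.
Definition i2 : idx := lift ord0 (lift ord0 ord0).
Definition ia (a : 'I_K) : idx := lift ord0 (lift ord0 (lift ord0 a)).

Definition scan (T : tapes) : symbols := [ffun j => scanned (T j)].

Definition move_tapes (a : idx -> symbol * direction) (T : tapes) : tapes :=
  [ffun j => move_head (a j).2 (write (a j).1 (T j))].

Definition ask_tapes (T : tapes) : tapes :=
  [ffun j => if j == i1 then tape_of (f (string_on (T i1))) else T j].

(* The time in [runs_halt] is arbitrary, so [t] is only an upper bound. *)
Inductive runs (p : prog) : pstate p -> tapes -> nat -> tapes -> Prop :=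
| runs_halt q T t : pact q = Halt _ _ -> runs q T t T
| runs_query q q' T t T' :
    pact q = Query _ q' -> runs q' (ask_tapes T) t T' -> runs q T t.+1 T'
| runs_step q delta T t T' :
    pact q = Step delta ->
    runs (delta (scan T)).1 (move_tapes (delta (scan T)).2 T) t T' ->
    runs q T t.+1 T'.

Lemma runs_leq (p : prog) (q : pstate p) T t t' T' : t <= t' -> runs q T t T' -> runs q T t' T'.
Proof.
move=> letT r; elim: r t' letT => {q T t T'} [q T t h | q q' T t T' h _ IH | q d T t T' h _ IH] [|t'] // le.
- exact: runs_halt.
- exact: runs_halt.
- exact: runs_query h (IH _ le).
- exact: runs_step h (IH _ le).
Qed.

Lemma runs_iter (p : prog) (q : pstate p) T t T' : runs q T t T' ->
  exists2 s, s <= t & exists2 q' : pstate p, pact q' = Halt _ _ &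
    iter s (next_config f) (Config (M := machine p) q T) = Config (M := machine p) q' T'.
Proof.
elim=> {q T t T'} [q T t h | q q' T t T' h _ [s les [q2 h2 e]] | q d T t T' h _ [s les [q2 h2 e]]].
- by exists 0 => //; exists q.
- exists s.+1 => //; exists q2 => //; rewrite iterSr -e; congr (iter _ _ _).
  by rewrite /next_config /= h.
- exists s.+1 => //; exists q2 => //; rewrite iterSr -e; congr (iter _ _ _).
  rewrite /next_config /= h -/(scan T); case: (d (scan T)) => //.
Qed.

(** Start and end are taken up to trailing blanks, so erased cells need not be tracked when programs
    are composed. *)
Definition exec (p : prog) (q : pstate p) (T T' : idx -> tape) (t : nat) : Prop :=
  forall T1 : tapes, (forall j, eqt (T1 j) (T j)) ->
  exists2 T2 : tapes, (forall j, eqt (T2 j) (T' j)) & runs q T1 t T2.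

Lemma exec_leq (p : prog) (q : pstate p) T T' t t' : t <= t' -> exec q T T' t -> exec q T T' t'.
Proof. by move=> le h T1 /h[T2 e r]; exists T2 => //; apply: runs_leq r. Qed.

Lemma exec_eqt (p : prog) (q : pstate p) S S' T T' t :
  (forall j, eqt (S j) (T j)) -> (forall j, eqt (T' j) (S' j)) ->
  exec q T T' t -> exec q S S' t.
Proof.
move=> e e' h T1 e1; have [|T2 e2 r] := h T1.
  by move=> j; apply: eqt_trans (e1 j) (e j).
by exists T2 => // j; apply: eqt_trans (e2 j) (e' j).
Qed.

Definition noop (s : symbols) : idx -> symbol * direction := fun j => (s j, Stay).

Lemma move_noop T : move_tapes (noop (scan T)) T = T.
Proof. by apply/ffunP=> j; rewrite ffunE /= ffunE; case: (T j). Qed.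

Definition map_action (Q Q' : Type) (g : Q -> Q') (a : action K.+3 Q) : action K.+3 Q' :=
  match a with
  | Halt => Halt _ _
  | Query q => Query _ (g q)
  | Step delta => Step (fun s => (g (delta s).1, (delta s).2))
  end.

Definition goto (Q : Type) (q : Q) : action K.+3 Q := Step (fun s => (q, noop s)).

Lemma runs_goto (p : prog) (q q' : pstate p) T t T' :
  pact q = goto q' -> runs q' T t T' -> runs q T t.+1 T'.
Proof. by move=> h r; apply: runs_step h _; rewrite /= move_noop. Qed.

(* [p] runs inside [p'], control passing from its halting states to [q']. *)
Lemma runs_embed (p p' : prog) (g : pstate p -> pstate p') (q' : pstate p') :
  (forall q, pact (g q) = if pact q is Halt then goto q' else map_action g (pact q)) ->
  forall q T t1 T1 t2 T2, runs q T t1 T1 -> runs q' T1 t2 T2 ->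
  runs (g q) T (t1 + t2).+1 T2.
Proof.
move=> hg q T t1 T1 t2 T2 r r2; elim: r r2 => {q T t1 T1}
    [q T t h | q q1 T t T' h _ IH | q d T t T' h _ IH] r2.
- apply: (@runs_leq _ _ _ t2.+1); first by rewrite ltnS leq_addl.
  by apply: runs_goto r2; rewrite hg h.
- by rewrite addSn; apply: (@runs_query _ _ (g q1)); [rewrite hg h | apply: IH].
- rewrite addSn; apply: runs_step; first by rewrite hg h.
  exact: IH.
Qed.

Lemma runs_map (p p' : prog) (g : pstate p -> pstate p') :
  (forall q, pact (g q) = map_action g (pact q)) ->
  forall q T t T', runs q T t T' -> runs (g q) T t T'.
Proof.
move=> hg q T t T'; elim=> {q T t T'} [q T t h | q q1 T t T' h _ IH | q d T t T' h _ IH].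
- by apply: runs_halt; rewrite hg h.
- by apply: (@runs_query _ _ (g q1)) => //; rewrite hg h.
- by apply: runs_step; first by rewrite hg h.
Qed.

Definition seqp (p1 p2 : prog) : prog :=
  @Prog (pstate p1 + pstate p2)%type (inl (pstart p1))
    (fun q => match q with
     | inl q => if pact q is Halt then goto (inr (pstart p2)) else map_action inl (pact q)
     | inr q => map_action inr (pact q)
     end).

(** State [inl false] evaluates the test, [inl true] halts, and the body returns to [inl false]. *)
Definition whilep (test : pred symbols) (p : prog) : prog :=
  @Prog (bool + pstate p)%type (inl false)
    (fun q => match q with
     | inl false => Step (fun s => (if test s then inr (pstart p) else inl true, noop s))
     | inl true => Halt _ _
     | inr q => if pact q is Halt then goto (inl false) else map_action inr (pact q)
     end).

Definition ifp (test : pred symbols) (p1 p2 : prog) : prog :=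
  @Prog (unit + (pstate p1 + pstate p2))%type (inl tt)
    (fun q => match q with
     | inl _ => Step (fun s =>
         (if test s then inr (inl (pstart p1)) else inr (inr (pstart p2)), noop s))
     | inr (inl q) => map_action (fun q => inr (inl q)) (pact q)
     | inr (inr q) => map_action (fun q => inr (inr q)) (pact q)
     end).

Definition askp : prog :=
  @Prog bool false (fun q => if q then Halt _ _ else Query _ true).

Definition transp (C : finType) (c0 : C)
    (delta : C -> symbols -> option (C * (idx -> cmd))) : prog :=
  @Prog (option C) (Some c0)
    (fun q => if q is Some c then Step (fun s =>
        if delta c s is Some (c', a) then (Some c', fun j => cmd_act (s j) (a j))
        else (None, noop s))
      else Halt _ _).

Definition skipp : prog := @Prog unit tt (fun _ => Halt _ _).

Definition execp (p : prog) := exec (pstart p).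

Lemma execp_skip T : execp skipp T T 0.
Proof. by move=> T1 e; exists T1 => //; apply: runs_halt. Qed.

Lemma execp_seq p1 p2 T1 T2 T3 t1 t2 :
  execp p1 T1 T2 t1 -> execp p2 T2 T3 t2 -> execp (seqp p1 p2) T1 T3 (t1 + t2).+1.
Proof.
move=> h1 h2 S1 /h1[S2 /h2[S3 e3 r3] r2]; exists S3 => //.
apply: (@runs_embed p1 (seqp p1 p2) inl (inr (pstart p2))) r2 _ => //.
exact: (@runs_map p2 (seqp p1 p2) inr).
Qed.

Definition scanf (T : idx -> tape) : symbols := [ffun j => scanned (T j)].

Lemma scan_eqt (T1 : tapes) T : (forall j, eqt (T1 j) (T j)) -> scan T1 = scanf T.
Proof. by move=> e; apply/ffunP=> j; rewrite !ffunE; case: (e j). Qed.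

Lemma execp_while_stop (test : pred symbols) p T : ~~ test (scanf T) -> execp (whilep test p) T T 1.
Proof.
move=> nt T1 e; exists T1 => //; apply: runs_step => //=.
rewrite (scan_eqt e) (negbTE nt) /= -(scan_eqt e) move_noop; exact: runs_halt.
Qed.

Lemma execp_while_step (test : pred symbols) p T1 T2 T3 t1 t2 : test (scanf T1) ->
  execp p T1 T2 t1 -> execp (whilep test p) T2 T3 t2 ->
  execp (whilep test p) T1 T3 (t1 + t2).+2.
Proof.
move=> ht h1 h2 S1 e1; have [S2 e2 r2] := h1 _ e1; have [S3 e3 r3] := h2 _ e2.
exists S3 => //; apply: runs_step => //=.
rewrite (scan_eqt e1) ht /= -(scan_eqt e1) move_noop.
by apply: (@runs_embed p (whilep test p) inr (inl false)) r2 r3.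
Qed.

Lemma execp_if_true (test : pred symbols) p1 p2 T T' t : test (scanf T) ->
  execp p1 T T' t -> execp (ifp test p1 p2) T T' t.+1.
Proof.
move=> ht h S e; have [S' e' r] := h _ e; exists S' => //.
apply: runs_step => //=; rewrite (scan_eqt e) ht /= -(scan_eqt e) move_noop.
exact: (@runs_map p1 (ifp test p1 p2) (fun q => inr (inl q))).
Qed.

Lemma execp_if_false (test : pred symbols) p1 p2 T T' t : ~~ test (scanf T) ->
  execp p2 T T' t -> execp (ifp test p1 p2) T T' t.+1.
Proof.
move=> nt h S e; have [S' e' r] := h _ e; exists S' => //.
apply: runs_step => //=; rewrite (scan_eqt e) (negbTE nt) /= -(scan_eqt e) move_noop.
exact: (@runs_map p2 (ifp test p1 p2) (fun q => inr (inr q))).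
Qed.

Lemma exec_trans_stop (C : finType) (c0 c : C) delta T :
  delta c (scanf T) = None -> exec (p := transp c0 delta) (Some c) T T 1.
Proof.
move=> h T1 e; exists T1 => //; apply: runs_step => //=.
by rewrite (scan_eqt e) h /= -(scan_eqt e) move_noop; apply: runs_halt.
Qed.

Lemma exec_trans_step (C : finType) (c0 c c' : C) delta a T T' t :
  delta c (scanf T) = Some (c', a) ->
  exec (p := transp c0 delta) (Some c') (fun j => apply_cmd (a j) (T j)) T' t ->
  exec (p := transp c0 delta) (Some c) T T' t.+1.
Proof.
move=> h hr T1 e.
have [|T2 e2 r] := hr [ffun j => apply_cmd (a j) (T1 j)].
  move=> j; rewrite ffunE; apply: eqt_move.
  by case: (a j).1 => [x|]; [apply: eqt_write | ].
exists T2 => //; apply: runs_step => //=.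
rewrite (scan_eqt e) h /= -(scan_eqt e).
have -> : move_tapes (fun j => cmd_act (scan T1 j) (a j)) T1 = [ffun j => apply_cmd (a j) (T1 j)].
  by apply/ffunP => j; rewrite !ffunE cmd_actE.
exact: r.
Qed.

Lemma ask_eqt (T1 : tapes) T : (forall j, eqt (T1 j) (T j)) ->
  forall j, eqt (ask_tapes T1 j)
    (if j == i1 then tape_of (f (string_on (T i1))) else T j).
Proof.
move=> e j; rewrite ffunE; case: eqP => // _.
by rewrite (string_on_eqt (e i1)).
Qed.

Lemma execp_ask T :
  execp askp T (fun j => if j == i1 then tape_of (f (string_on (T i1))) else T j) 1.
Proof.
move=> T1 e; exists (ask_tapes T1); first exact: ask_eqt.
by apply: (@runs_query askp false true) => //; apply: runs_halt.
Qed.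

(* Tapes: 0 input and output, 1 oracle, 2 a counter holding [1^n] for an input graph with [n + 1]
   vertices, and one tape for each of the [K] answers. *)
Definition mk (X : Type) (x0 x1 x2 : X) (xa : 'I_K -> X) (j : idx) : X :=
  if unlift ord0 j is Some j then
    if unlift ord0 j is Some j then
      if unlift ord0 j is Some a then xa a else x2
    else x1
  else x0.

Lemma mk0 X x0 x1 x2 (xa : 'I_K -> X) : mk x0 x1 x2 xa i0 = x0.
Proof. by rewrite /mk unlift_none. Qed.

Lemma mk1 X x0 x1 x2 (xa : 'I_K -> X) : mk x0 x1 x2 xa i1 = x1.
Proof. by rewrite /mk liftK unlift_none. Qed.

Lemma mk2 X x0 x1 x2 (xa : 'I_K -> X) : mk x0 x1 x2 xa i2 = x2.
Proof. by rewrite /mk !liftK unlift_none. Qed.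

Lemma mka X x0 x1 x2 (xa : 'I_K -> X) a : mk x0 x1 x2 xa (ia a) = xa a.
Proof. by rewrite /mk !liftK. Qed.

Definition mkE := (mk0, mk1, mk2, mka).

Lemma idxP (P : idx -> Prop) : P i0 -> P i1 -> P i2 -> (forall a, P (ia a)) -> forall j, P j.
Proof.
move=> h0 h1 h2 ha j; case: (unliftP ord0 j) => [j1|] ->; last exact: h0.
case: (unliftP ord0 j1) => [j2|] ->; last exact: h1.
by case: (unliftP ord0 j2) => [a|] ->; [apply: ha | apply: h2].
Qed.

Definition cmds := (cmd * cmd * cmd * ('I_K -> cmd))%type.
Definition mk_cmds (c : cmds) : idx -> cmd := mk c.1.1.1 c.1.1.2 c.1.2 c.2.

Definition trp (C : finType) (c0 : C)
    (delta : C -> symbol -> symbol -> symbol -> {ffun 'I_K -> symbol} -> option (C * cmds)) : prog :=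
  transp c0 (fun c s =>
    if delta c (s i0) (s i1) (s i2) [ffun a => s (ia a)] is Some (c', a)
    then Some (c', mk_cmds a) else None).

Lemma scanf_mk t0 t1 t2 A :
  [/\ scanf (mk t0 t1 t2 A) i0 = scanned t0, scanf (mk t0 t1 t2 A) i1 = scanned t1,
      scanf (mk t0 t1 t2 A) i2 = scanned t2 &
      [ffun a => scanf (mk t0 t1 t2 A) (ia a)] = [ffun a => scanned (A a)]].
Proof.
by split; rewrite ?ffunE ?mkE //; apply/ffunP=> a; rewrite !ffunE mkE.
Qed.

Lemma exec_tr_stop (C : finType) (c0 c : C) delta t0 t1 t2 A :
  delta c (scanned t0) (scanned t1) (scanned t2) [ffun a => scanned (A a)] = None ->
  exec (p := trp c0 delta) (Some c) (mk t0 t1 t2 A) (mk t0 t1 t2 A) 1.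
Proof.
move=> h; apply: exec_trans_stop.
by have [-> -> -> ->] := scanf_mk t0 t1 t2 A; rewrite h.
Qed.

Lemma exec_tr_step (C : finType) (c0 c c' : C) delta a t0 t1 t2 A T' t :
  delta c (scanned t0) (scanned t1) (scanned t2) [ffun a => scanned (A a)] = Some (c', a) ->
  exec (p := trp c0 delta) (Some c')
    (mk (apply_cmd a.1.1.1 t0) (apply_cmd a.1.1.2 t1) (apply_cmd a.1.2 t2)
        (fun b => apply_cmd (a.2 b) (A b))) T' t ->
  exec (p := trp c0 delta) (Some c) (mk t0 t1 t2 A) T' t.+1.
Proof.
move=> h hr; apply: (exec_trans_step (c' := c') (a := mk_cmds a)).
  by have [-> -> -> ->] := scanf_mk t0 t1 t2 A; rewrite h.
apply: exec_eqt hr => // j.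
by elim/idxP: j => [|||b]; rewrite /mk_cmds !mkE.
Qed.

Definition dop (g : symbol -> symbol -> symbol -> {ffun 'I_K -> symbol} -> cmds) : prog :=
  trp true (fun c s0 s1 s2 sa => if c then Some (false, g s0 s1 s2 sa) else None).

Lemma execp_do g t0 t1 t2 A :
  let a := g (scanned t0) (scanned t1) (scanned t2) [ffun a => scanned (A a)] in
  execp (dop g) (mk t0 t1 t2 A)
    (mk (apply_cmd a.1.1.1 t0) (apply_cmd a.1.1.2 t1) (apply_cmd a.1.2 t2)
        (fun b => apply_cmd (a.2 b) (A b))) 2.
Proof. by move=> a; apply: exec_tr_step => //; apply: exec_tr_stop. Qed.

Definition loopp (test : symbol -> symbol -> symbol -> bool)
    (g : symbol -> symbol -> symbol -> {ffun 'I_K -> symbol} -> cmds) : prog :=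
  trp tt (fun _ s0 s1 s2 sa => if test s0 s1 s2 then Some (tt, g s0 s1 s2 sa) else None).

Lemma execp_loop_stop test g t0 t1 t2 A :
  ~~ test (scanned t0) (scanned t1) (scanned t2) ->
  execp (loopp test g) (mk t0 t1 t2 A) (mk t0 t1 t2 A) 1.
Proof. by move=> nt; apply: exec_tr_stop; rewrite (negbTE nt). Qed.

Lemma execp_loop_step (test : symbol -> symbol -> symbol -> bool) g t0 t1 t2 A T' t :
  test (scanned t0) (scanned t1) (scanned t2) ->
  let a := g (scanned t0) (scanned t1) (scanned t2) [ffun a => scanned (A a)] in
  execp (loopp test g)
    (mk (apply_cmd a.1.1.1 t0) (apply_cmd a.1.1.2 t1) (apply_cmd a.1.2 t2)
        (fun b => apply_cmd (a.2 b) (A b))) T' t ->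
  execp (loopp test g) (mk t0 t1 t2 A) T' t.+1.
Proof. by move=> ht a h; apply: exec_tr_step h; rewrite ht. Qed.

(** * Moving and rewinding one tape *)

Definition upd (T : idx -> tape) (j : idx) (t : tape) : idx -> tape :=
  fun i => if i == j then t else T i.

Definition one_cmd (j : idx) (c : cmd) : idx -> cmd := fun i => if i == j then c else keep.

Definition movep (j : idx) (d : direction) : prog :=
  transp true (fun c _ => if c then Some (false, one_cmd j (go d)) else None).

Lemma execp_move j d T t : eqt (T j) t -> execp (movep j d) T (upd T j (move_head d t)) 2.
Proof.
move=> e; apply: exec_trans_step => //.
apply: exec_eqt (exec_trans_stop _ _) => // i; rewrite /upd /one_cmd.
by case: eqP => [->|_] //; apply: eqt_move.
Qed.

Definition leftp (j : idx) : prog :=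
  transp tt (fun _ s => if s j is Some _ then Some (tt, one_cmd j (go Left)) else None).

(** The head goes left, so [x] lists the string from its end; the hypothesis on [l] provides the
    blank that stops the loop. *)
Lemma execp_left j (x : bitstring) l s T : head None l = None ->
  execp (leftp j)
    (upd T j (cur (behead (map Some x ++ l)) (head None (map Some x ++ l) :: s)))
    (upd T j (cur (behead l) (None :: catrev (map Some x) s))) (size x).+1.
Proof.
move=> hl; elim: x s => [|b x IHx] s /=.
  by rewrite hl; apply: exec_trans_stop; rewrite ffunE /upd eqxx.
apply: exec_trans_step; first by rewrite ffunE /upd eqxx.
apply: exec_eqt (IHx (Some b :: s)) => // i; rewrite /upd /one_cmd.
by case: eqP => // _; apply: move_left_cur.
Qed.

(** The head starts just behind the string, so it steps left before the loop; the loop ends on the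
    blank in front of the string, and the last move corrects this. *)
Definition rewindp (j : idx) : prog := seqp (movep j Left) (seqp (leftp j) (movep j Right)).

Lemma execp_rewind j (w : bitstring) l s T : head None l = None ->
  eqt (T j) (cur (catrev (map Some w) l) s) ->
  execp (rewindp j) T (upd T j (cur l (map Some w ++ s))) (size w + 7).
Proof.
move=> hl e.
have h1 := execp_move Left e.
have h2 := @execp_left j (rev w) l s T hl.
have h3 := @execp_move j Right (upd T j (cur (behead l) (None :: catrev (map Some (rev w)) s)))
  (cur (behead l) (None :: catrev (map Some (rev w)) s)).
have {h3} h3 : execp (movep j Right) (upd T j (cur (behead l) (None :: catrev (map Some (rev w)) s)))
    (upd T j (cur l (map Some w ++ s))) 2.
  apply: exec_eqt (h3 _); [by [] | | by rewrite /upd eqxx].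
  move=> i; rewrite /upd; case: eqP => // _.
  (* The move to the right puts a blank back in front of [behead l]; this is [l] up to trailing
     blanks, since [l] is empty or begins with a blank. *)
  rewrite map_rev catrevE revK; apply: eqt_cur => // k.
  by case: (l) hl => [|c l'] /= => [_|->]; case: k => //= k; rewrite nth_nil.
have {h1} h1 : execp (movep j Left) T (upd T j (cur (behead (map Some (rev w) ++ l))
    (head None (map Some (rev w) ++ l) :: s))) 2.
  apply: exec_eqt h1 => // i; rewrite /upd; case: eqP => // _.
  by rewrite map_rev -catrevE; apply: move_left_cur.
apply: exec_leq (execp_seq h1 (execp_seq h2 h3)); rewrite size_rev; lia.
Qed.

Lemma upd_mk0 t0 t1 t2 A t j : upd (mk t0 t1 t2 A) i0 t j = mk t t1 t2 A j.
Proof. by rewrite /upd; elim/idxP: j => [|||b]; rewrite !mkE. Qed.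

Lemma upd_mk1 t0 t1 t2 A t j : upd (mk t0 t1 t2 A) i1 t j = mk t0 t t2 A j.
Proof. by rewrite /upd; elim/idxP: j => [|||b]; rewrite !mkE. Qed.

Lemma upd_mk2 t0 t1 t2 A t j : upd (mk t0 t1 t2 A) i2 t j = mk t0 t1 t A j.
Proof. by rewrite /upd; elim/idxP: j => [|||b]; rewrite !mkE. Qed.

Definition set_ans (A : 'I_K -> tape) (a : 'I_K) (t : tape) : 'I_K -> tape :=
  fun b => if b == a then t else A b.

Lemma upd_mka t0 t1 t2 A a t j : upd (mk t0 t1 t2 A) (ia a) t j = mk t0 t1 t2 (set_ans A a t) j.
Proof.
by rewrite /upd /set_ans; elim/idxP: j => [|||b]; rewrite !mkE.
Qed.

Lemma execp_ext p T T' S S' t : T =1 S -> T' =1 S' -> execp p T T' t -> execp p S S' t.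
Proof. by move=> e e'; apply: exec_eqt => j; rewrite ?e ?e'. Qed.

(** * Programs that read the input and append to the oracle tape *)

Definition kept : 'I_K -> cmd := fun _ => keep.

Definition emitp (b : bool) : prog := dop (fun _ _ _ _ => (keep, put (Some b) Right, keep, kept)).
Definition emitsp (bs : bitstring) : prog := foldr (fun b p => seqp (emitp b) p) skipp bs.
Definition copyp : prog := dop (fun s0 _ _ _ => (go Right, put s0 Right, keep, kept)).
Definition onesp : prog :=
  loopp (fun s0 _ _ => s0 == Some true) (fun s0 _ _ _ => (go Right, put s0 Right, keep, kept)).
(** The counter on tape 2 sets the number of iterations and is rewound for its next use. *)
Definition fillp : prog :=
  seqp (loopp (fun _ _ s2 => s2 == Some true)
          (fun _ _ _ _ => (keep, put (Some false) Right, go Right, kept))) (rewindp i2).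
Definition copiesp : prog :=
  seqp (loopp (fun _ _ s2 => s2 == Some true)
          (fun s0 _ _ _ => (go Right, put s0 Right, go Right, kept))) (rewindp i2).

Section Transduce.
Variable n : nat.

Definition counter : tape := cur [::] (map Some (nseq n true)).

(* With [1^n] on tape 2, [p] reads [x] from tape 0, where [y] follows, and appends [e] to tape 1. *)
Definition transduces (p : prog) (x y e : bitstring) (t : nat) : Prop :=
  forall l0 l1 A,
    execp p (mk (cur l0 (map Some (x ++ y))) (cur l1 [::]) counter A)
      (mk (cur (catrev (map Some x) l0) (map Some y)) (cur (catrev (map Some e) l1) [::])
         counter A) t.

Lemma transduces_leq p x y e t t' : t <= t' -> transduces p x y e t -> transduces p x y e t'.
Proof. by move=> le h l0 l1 A; apply: exec_leq le (h l0 l1 A). Qed.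

Lemma catrev_cat (T : Type) (a b c : seq T) : catrev (a ++ b) c = catrev b (catrev a c).
Proof. by rewrite !catrevE rev_cat catA. Qed.

Lemma transduces_seq p p' x x' y e e' t t' :
  transduces p x (x' ++ y) e t -> transduces p' x' y e' t' ->
  transduces (seqp p p') (x ++ x') y (e ++ e') (t + t').+1.
Proof.
move=> h h' l0 l1 A; rewrite -catA !map_cat !catrev_cat -!map_cat.
exact: execp_seq (h _ _ _) (h' _ _ _).
Qed.

Lemma transduces_skip y : transduces skipp [::] y [::] 0.
Proof. by move=> l0 l1 A; apply: execp_skip. Qed.

Lemma transduces_emit b y : transduces (emitp b) [::] y [:: b] 2.
Proof.
move=> l0 l1 A.
exact: (@execp_do (fun _ _ _ _ => (keep, put (Some b) Right, keep, kept))
  (cur l0 (map Some y)) (cur l1 [::])).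
Qed.

Lemma transduces_emits bs y : transduces (emitsp bs) [::] y bs (3 * size bs).
Proof.
elim: bs => [|b bs IHbs] /=; first exact: transduces_skip.
have h : transduces _ _ _ _ _ := transduces_seq (@transduces_emit b ([::] ++ y)) IHbs.
apply: transduces_leq h; lia.
Qed.

Lemma transduces_copy b y : transduces copyp [:: b] y [:: b] 2.
Proof.
move=> l0 l1 A.
exact: (@execp_do (fun s0 _ _ _ => (go Right, put s0 Right, keep, kept))
  (cur l0 (map Some (b :: y))) (cur l1 [::])).
Qed.

Lemma transduces_ones k y :
  transduces onesp (nseq k true) (false :: y) (nseq k true) k.+1.
Proof.
move=> l0 l1 A; elim: k => [|k IHk] in l0 l1 *; first exact: execp_loop_stop.
by apply: execp_loop_step => //=; apply: IHk.
Qed.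

Lemma execp_rewind_counter t0 t1 A :
  execp (rewindp i2) (mk t0 t1 (cur (catrev (map Some (nseq n true)) [::]) [::]) A)
    (mk t0 t1 counter A) (n + 7).
Proof.
apply: (@execp_ext _ (mk t0 t1 (cur (catrev (map Some (nseq n true)) [::]) [::]) A)) (frefl _)
  (@upd_mk2 _ _ _ _ _) _.
rewrite -[X in X + 7](size_nseq n true) -[X in upd _ _ (cur _ X)]cats0.
by apply: execp_rewind => //; rewrite mkE.
Qed.

Lemma transduces_fill y : transduces fillp [::] y (nseq n false) (2 * n + 9).
Proof.
move=> l0 l1 A.
have gen t0 k l l2 : execp (loopp (fun _ _ s2 => s2 == Some true)
      (fun _ _ _ _ => (keep, put (Some false) Right, go Right, kept)))
    (mk t0 (cur l [::]) (cur l2 (map Some (nseq k true))) A)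
    (mk t0 (cur (catrev (map Some (nseq k false)) l) [::])
       (cur (catrev (map Some (nseq k true)) l2) [::]) A) k.+1.
  elim: k => [|k IHk] in l l2 *; first exact: execp_loop_stop.
  by apply: execp_loop_step => //=; apply: IHk.
have h := execp_seq (gen (cur l0 (map Some y)) n l1 [::])
  (@execp_rewind_counter _ _ _).
by apply: exec_leq h; lia.
Qed.

Lemma transduces_copies x y : size x = n -> transduces copiesp x y x (2 * n + 9).
Proof.
move=> sx l0 l1 A.
have gen l l' l2 : execp (loopp (fun _ _ s2 => s2 == Some true)
      (fun s0 _ _ _ => (go Right, put s0 Right, go Right, kept)))
    (mk (cur l (map Some (x ++ y))) (cur l' [::]) (cur l2 (map Some (nseq (size x) true))) A)
    (mk (cur (catrev (map Some x) l) (map Some y)) (cur (catrev (map Some x) l') [::])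
       (cur (catrev (map Some (nseq (size x) true)) l2) [::]) A) (size x).+1.
  elim: (x) => [|b u IHu] in l l' l2 *; first exact: execp_loop_stop.
  by apply: execp_loop_step => //=; apply: IHu.
have {gen} := gen l0 l1 [::]; rewrite sx => h.
by apply: exec_leq (execp_seq h (@execp_rewind_counter _ _ _)); lia.
Qed.

End Transduce.

(** * Writing a query *)

(** A vertex other than the root has no neighbour in the gadget, hence the [m] zeros. Its row has
    [n + 1] bits while the counter holds [n], hence the separate copy of the first bit. *)
Definition rowp (m : nat) : prog := seqp (emitsp (nseq m false)) (seqp copyp copiesp).

Definition gadget_rowsp (B : seq bitstring) : prog :=
  foldr (fun b p => seqp (seqp (emitsp b) fillp) p) skipp B.

(** One piece for each block of the query: the size in unary, the separator, the gadget rows, the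
    root row preceded by the marks, and the other rows until the input ends. *)
Definition buildp (m : nat) (B : seq bitstring) (ab : bitstring) : prog :=
  seqp (emitsp (nseq m true)) (seqp onesp (seqp copyp (seqp (gadget_rowsp B)
    (seqp (emitsp ab) (seqp copyp (seqp copiesp
      (whilep (fun s => s i0 != None) (rowp m)))))))).

(* The code of a glued graph, gadget vertices first: [m] vertices in the gadget, whose adjacency rows,
   each followed by its mark, form [B]; [ab] lists the marks; the gadget is attached to the first vertex
   of the input graph, whose rows are [row0] and [rows]. *)
Definition glue_string (m : nat) (B : seq bitstring) (ab : bitstring)
    (n : nat) (row0 : bitstring) (rows : seq bitstring) : bitstring :=
  nseq m true ++ nseq n.+1 true ++ false :: flatten [seq b ++ nseq n false | b <- B] ++
  ab ++ row0 ++ flatten [seq nseq m false ++ r | r <- rows].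

Definition input_string (n : nat) (row0 : bitstring) (rows : seq bitstring) : bitstring :=
  nseq n.+1 true ++ false :: row0 ++ flatten rows.

Definition build_time (m n : nat) : nat := (m + n + 8) * (3 * m + 2 * n + 30).

Lemma transduces_row n m b r y : size r = n ->
  transduces n (rowp m) (b :: r) y (nseq m false ++ b :: r) (3 * m + 2 * n + 13).
Proof.
move=> sr.
have h := transduces_seq (@transduces_copy n b (r ++ y)) (@transduces_copies n r y sr).
have {}h : transduces n (rowp m) _ _ _ _ :=
  transduces_seq (@transduces_emits n (nseq m false) ((b :: r) ++ y)) h.
by apply: transduces_leq h; rewrite size_nseq; lia.
Qed.

Lemma transduces_while n p x x' y e e' t t' : x != [::] ->
  transduces n p x (x' ++ y) e t ->
  transduces n (whilep (fun s => s i0 != None) p) x' y e' t' ->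
  transduces n (whilep (fun s => s i0 != None) p) (x ++ x') y (e ++ e') (t + t').+2.
Proof.
move=> nx h h' l0 l1 A; rewrite -catA !map_cat !catrev_cat -!map_cat.
apply: execp_while_step (h _ _ _) (h' _ _ _).
by rewrite ffunE mkE; case: (x) nx.
Qed.

Lemma transduces_rows n m rows : all (fun r => size r == n.+1) rows ->
  transduces n (whilep (fun s => s i0 != None) (rowp m)) (flatten rows) [::]
    (flatten [seq nseq m false ++ r | r <- rows]) (size rows * (3 * m + 2 * n + 15) + 1).
Proof.
elim: rows => [|[|b r] rows IHr] //= => [_|/andP[/eqP[sr] ar]].
  by move=> l0 l1 A; apply: execp_while_stop; rewrite ffunE mkE.
have h : transduces n _ _ _ _ _ := transduces_while (x := b :: r) isT
  (@transduces_row n m b r (flatten rows ++ [::]) sr) (IHr ar).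
by apply: transduces_leq h; lia.
Qed.

Lemma transduces_gadget_rows n B y k : all (fun b => size b == k) B ->
  transduces n (gadget_rowsp B) [::] y (flatten [seq b ++ nseq n false | b <- B])
    (size B * (3 * k + 2 * n + 11)).
Proof.
elim: B => [|b B IHB] /= => [_|/andP[/eqP sb aB]]; first exact: transduces_skip.
have h := transduces_seq (@transduces_emits n b ([::] ++ y)) (@transduces_fill n y).
have h2 : transduces n _ _ _ _ _ := transduces_seq (x' := [::]) h (IHB aB).
by apply: transduces_leq h2; rewrite sb; lia.
Qed.

Lemma transduces_build n m B ab row0 rows :
  size B = m -> all (fun b => size b == m.+1) B -> size ab = m ->
  size row0 = n.+1 -> size rows = n -> all (fun r => size r == n.+1) rows ->
  transduces n (buildp m B ab) (input_string n row0 rows) [::]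
    (glue_string m B ab n row0 rows) (build_time m n).
Proof.
move=> sB aB sab; case: row0 => // b0 r0 [sr0] srows arows.
have h := transduces_rows m arows.
have {}h := transduces_seq (@transduces_copies n r0 (flatten rows ++ [::]) sr0) h.
have {}h := transduces_seq (@transduces_copy n b0 ((r0 ++ flatten rows) ++ [::])) h.
have {}h := transduces_seq
  (@transduces_emits n ab (([:: b0] ++ r0 ++ flatten rows) ++ [::])) h.
have {}h := transduces_seq
  (@transduces_gadget_rows n B (([::] ++ [:: b0] ++ r0 ++ flatten rows) ++ [::]) _ aB) h.
have {}h := transduces_seq (@transduces_copy n false
  (([::] ++ [::] ++ [:: b0] ++ r0 ++ flatten rows) ++ [::])) h.
have {}h := transduces_seq (@transduces_ones n n.+1
  (([::] ++ [::] ++ [:: b0] ++ r0 ++ flatten rows) ++ [::]) :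
  transduces n onesp _ (([:: false] ++ [::] ++ [::] ++ [:: b0] ++ r0 ++ flatten rows) ++ [::]) _ _) h.
have {}h : transduces n (buildp m B ab) (input_string n (b0 :: r0) rows) [::]
  (glue_string m B ab n (b0 :: r0) rows) _ :=
  transduces_seq (@transduces_emits n (nseq m true) (input_string n (b0 :: r0) rows ++ [::])) h.
by apply: transduces_leq h; rewrite sB sab srows size_nseq /build_time; nia.
Qed.

(** * Asking the oracle and storing the answers *)

Lemma string_on_cur l (w : bitstring) : string_on (cur l (map Some w)) = w.
Proof. by case: w => //= b w; rewrite /string_on /=; congr cons; elim: w => //= c w ->. Qed.

(** The oracle tape is erased while it is read, so that the next query finds it blank. *)
Definition transferp (a : 'I_K) : prog :=
  loopp (fun _ s1 _ => s1 != None)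
    (fun _ s1 _ _ => (keep, put None Right, keep, fun b => if b == a then put s1 Right else keep)).

Lemma execp_transfer a t0 t2 A l1 l (v : bitstring) :
  execp (transferp a) (mk t0 (cur l1 (map Some v)) t2 (set_ans A a (cur l [::])))
    (mk t0 (cur (nseq (size v) None ++ l1) [::]) t2
       (set_ans A a (cur (catrev (map Some v) l) [::]))) (size v).+1.
Proof.
elim: v => [|b v IHv] in l1 l *; first exact: execp_loop_stop.
apply: execp_loop_step => //=; apply: exec_eqt (IHv (None :: l1) (Some b :: l)) => j.
  elim/idxP: j => [|||c]; rewrite !mkE // /set_ans.
  by case: eqP.
elim/idxP: j => [|||c]; rewrite !mkE //.
by rewrite -(cat1s None l1) catA -[_ ++ [:: None]]/(nseq _ None ++ nseq 1 None) -nseqD addn1.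
Qed.

Definition queryp (a : 'I_K) (m : nat) (B : seq bitstring) (ab : bitstring) : prog :=
  seqp (buildp m B ab) (seqp (rewindp i1) (seqp askp (seqp (transferp a)
    (seqp (rewindp (ia a)) (rewindp i0))))).

Lemma execp_rewind0 (w : bitstring) l s t1 t2 A : head None l = None ->
  execp (rewindp i0) (mk (cur (catrev (map Some w) l) s) t1 t2 A)
    (mk (cur l (map Some w ++ s)) t1 t2 A) (size w + 7).
Proof.
move=> hl; apply: execp_ext (frefl _) (@upd_mk0 _ _ _ _ _) (execp_rewind hl _).
by rewrite mkE.
Qed.

Lemma execp_rewind1 (w : bitstring) t0 l s t2 A : head None l = None ->
  execp (rewindp i1) (mk t0 (cur (catrev (map Some w) l) s) t2 A)
    (mk t0 (cur l (map Some w ++ s)) t2 A) (size w + 7).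
Proof.
move=> hl; apply: execp_ext (frefl _) (@upd_mk1 _ _ _ _ _) (execp_rewind hl _).
by rewrite mkE.
Qed.

Lemma execp_rewinda a (w : bitstring) t0 t1 t2 A l s : head None l = None ->
  execp (rewindp (ia a)) (mk t0 t1 t2 (set_ans A a (cur (catrev (map Some w) l) s)))
    (mk t0 t1 t2 (set_ans A a (cur l (map Some w ++ s)))) (size w + 7).
Proof.
move=> hl.
have e : eqt (mk t0 t1 t2 (set_ans A a (cur (catrev (map Some w) l) s)) (ia a))
    (cur (catrev (map Some w) l) s) by rewrite mkE /set_ans eqxx.
apply: execp_ext (frefl _) _ (execp_rewind hl e) => j; rewrite upd_mka.
by elim/idxP: j => [|||c]; rewrite !mkE // /set_ans; case: eqP.
Qed.

Definition blank : tape := cur [::] [::].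

Lemma execp_query a m n B ab row0 rows A v
    (w := input_string n row0 rows) (q := glue_string m B ab n row0 rows) :
  size B = m -> all (fun b => size b == m.+1) B -> size ab = m ->
  size row0 = n.+1 -> size rows = n -> all (fun r => size r == n.+1) rows ->
  f q = v -> A a = blank ->
  execp (queryp a m B ab) (mk (cur [::] (map Some w)) blank (counter n) A)
    (mk (cur [::] (map Some w)) blank (counter n) (set_ans A a (cur [::] (map Some v))))
    (build_time m n + size q + size w + 2 * size v + 30).
Proof.
move=> sB aB sab sr0 srows arows fq Aa.
have h1 := transduces_build sB aB sab sr0 srows arows (l0 := [::]) (l1 := [::]) (A := A).
rewrite cats0 -/w -/q in h1.
have h2 := @execp_rewind1 q (cur (catrev (map Some w) [::]) [::]) [::] [::] (counter n) A erefl.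
have h3 : execp askp (mk (cur (catrev (map Some w) [::]) [::]) (cur [::] (map Some q ++ [::])) (counter n) A)
   (mk (cur (catrev (map Some w) [::]) [::]) (cur [::] (map Some v)) (counter n) (set_ans A a blank)) 1.
  apply: exec_eqt (@execp_ask _) => // j.
  elim/idxP: j => [|||c]; rewrite !mkE //=.
    by rewrite cats0 string_on_cur fq tape_of_cur.
  by rewrite /set_ans; case: eqP => // ->; rewrite Aa.
have h4 := @execp_transfer a (cur (catrev (map Some w) [::]) [::]) (counter n) A [::] [::] v.
have h5 := @execp_rewinda a v (cur (catrev (map Some w) [::]) [::])
  (cur (nseq (size v) None ++ [::]) [::]) (counter n) A [::] [::] erefl.
have h6 := @execp_rewind0 w [::] [::] (cur (nseq (size v) None ++ [::]) [::]) (counter n)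
  (set_ans A a (cur [::] (map Some v ++ [::]))) erefl.
have h := execp_seq h1 (execp_seq h2 (execp_seq h3 (execp_seq h4 (execp_seq h5 h6)))).
apply: exec_leq (exec_eqt _ _ h); [lia | by [] | move=> j].
elim/idxP: j => [|||c]; rewrite !mkE ?cats0 //.
exact: (cur_blanks [::]).
Qed.

Definition queriesp (m : 'I_K -> nat) (B : 'I_K -> seq bitstring) (ab : 'I_K -> bitstring)
    (s : seq 'I_K) : prog :=
  foldr (fun a p => seqp (queryp a (m a) (B a) (ab a)) p) skipp s.

Lemma execp_queries m B ab n row0 rows v (s : seq 'I_K)
    (w := input_string n row0 rows) (q := fun a => glue_string (m a) (B a) (ab a) n row0 rows) :
  (forall a, size (B a) = m a) -> (forall a, all (fun b => size b == (m a).+1) (B a)) ->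
  (forall a, size (ab a) = m a) ->
  size row0 = n.+1 -> size rows = n -> all (fun r => size r == n.+1) rows ->
  (forall a, f (q a) = v a) -> uniq s -> forall A, {in s, forall a, A a = blank} ->
  execp (queriesp m B ab s) (mk (cur [::] (map Some w)) blank (counter n) A)
    (mk (cur [::] (map Some w)) blank (counter n)
      (fun a => if a \in s then cur [::] (map Some (v a)) else A a))
    (\sum_(a <- s) (build_time (m a) n + size (q a) + size w + 2 * size (v a) + 31)).
Proof.
move=> sB aB sab sr0 srows arows fq; elim: s => [_|a s IHs /= /andP[nas us]] A As.
  by rewrite big_nil; apply: execp_skip.
have h1 := execp_query (sB a) (aB a) (sab a) sr0 srows arows (fq a) (As a (mem_head _ _)).
have h2 := IHs us (set_ans A a (cur [::] (map Some (v a)))).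
have {}h2 := h2 _; rewrite big_cons; apply: exec_leq; last first.
  apply: exec_eqt (execp_seq h1 (h2 _)) => //.
    move=> j; elim/idxP: j => [|||c]; rewrite !mkE // inE /set_ans.
    by case: eqP => [->|_] //=; rewrite (negbTE nas).
  (* [s] has no repetitions, so the tapes of the remaining queries are still blank. *)
  move=> b bs; rewrite /set_ans ifN; first by apply: As; rewrite inE bs orbT.
  by apply: contraNneq nas => <-.
by rewrite -addSn leq_add2r -addnS.
Qed.

(** * Preparing the counter and writing the output *)

Lemma execp_move0 d t0 t1 t2 A :
  execp (movep i0 d) (mk t0 t1 t2 A) (mk (move_head d t0) t1 t2 A) 2.
Proof. by apply: execp_ext (frefl _) (@upd_mk0 _ _ _ _ _) (execp_move d _); rewrite mkE. Qed.

(** The first move skips one of the [n + 1] ones, which leaves [n] of them for the counter. *)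
Definition initp : prog :=
  seqp (movep i0 Right) (seqp (loopp (fun s0 _ _ => s0 == Some true)
      (fun s0 _ _ _ => (go Right, keep, put s0 Right, kept)))
    (seqp (rewindp i2) (rewindp i0))).

Lemma execp_init n u t1 A :
  execp initp (mk (cur [::] (map Some (nseq n.+1 true ++ false :: u))) t1 blank A)
    (mk (cur [::] (map Some (nseq n.+1 true ++ false :: u))) t1 (counter n) A) (3 * n + 21).
Proof.
have h1 := @execp_move0 Right (cur [::] (map Some (nseq n.+1 true ++ false :: u))) t1 blank A.
have gen k l l2 : execp (loopp (fun s0 _ _ => s0 == Some true)
      (fun s0 _ _ _ => (go Right, keep, put s0 Right, kept)))
    (mk (cur l (map Some (nseq k true ++ false :: u))) t1 (cur l2 [::]) A)
    (mk (cur (catrev (map Some (nseq k true)) l) (map Some (false :: u))) t1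
       (cur (catrev (map Some (nseq k true)) l2) [::]) A) k.+1.
  elim: k => [|k IHk] in l l2 *; first exact: execp_loop_stop.
  by apply: execp_loop_step => //=; apply: IHk.
have h3 := @execp_rewind_counter n
  (cur (catrev (map Some (nseq n.+1 true)) [::]) (map Some (false :: u))) t1 A.
have h4 := @execp_rewind0 (nseq n.+1 true) [::] (map Some (false :: u)) t1 (counter n) A erefl.
have h := execp_seq h1 (execp_seq (gen n [:: Some true] [::]) (execp_seq h3 h4)).
by rewrite -map_cat in h; apply: exec_leq h; rewrite size_nseq; lia.
Qed.

Definition endp : prog :=
  loopp (fun s0 _ _ => s0 != None) (fun _ _ _ _ => (go Right, keep, keep, kept)).

Lemma execp_end (w : bitstring) l t1 t2 A :
  execp endp (mk (cur l (map Some w)) t1 t2 A) (mk (cur (catrev (map Some w) l) [::]) t1 t2 A)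
    (size w).+1.
Proof.
elim: w => [|b w IHw] in l *; first exact: execp_loop_stop.
by apply: execp_loop_step => //=; apply: IHw.
Qed.

(* The answer is written from the least significant bit on, so leading zeros are trailing cells. *)
Definition erasep : prog :=
  seqp (movep i0 Left) (seqp (loopp (fun s0 _ _ => s0 == Some false)
    (fun _ _ _ _ => (put None Left, keep, keep, kept))) (movep i0 Right)).

Lemma execp_erase (s : bitstring) z l t1 t2 A : (s == [::]) || last false s ->
  execp erasep (mk (cur (catrev (map Some (s ++ nseq z false)) (None :: l)) [::]) t1 t2 A)
    (mk (cur (catrev (map Some s) (None :: l)) [::]) t1 t2 A) (z + 7).
Proof.
move=> hs; pose L := catrev (map Some s) (None :: l).
(* The erasing loop stops at the last bit of [s], which is [true], or at the blank in front if [s]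
   is empty. *)
have hL : head None L != Some false.
  rewrite /L catrevE -map_rev; case: (lastP s) hs => // s' b; rewrite last_rcons.
  by rewrite rev_rcons /=; case: b => //; rewrite orbF -size_eq0 size_rcons.
have gen k j : execp (loopp (fun s0 _ _ => s0 == Some false)
    (fun _ _ _ _ => (put None Left, keep, keep, kept)))
    (mk (cur (behead (nseq k (Some false) ++ L)) (head None (nseq k (Some false) ++ L) :: nseq j None)) t1 t2 A)
    (mk (cur (behead L) (head None L :: nseq (j + k) None)) t1 t2 A) k.+1.
  elim: k j => [|k IHk] j /=; first by rewrite addn0; apply: execp_loop_stop.
  apply: execp_loop_step => //=; apply: exec_eqt (IHk j.+1) => i; last by rewrite addnS addSn.
  by elim/idxP: i => [|||c]; rewrite !mkE.
have e0 : catrev (map Some (s ++ nseq z false)) (None :: l) = nseq z (Some false) ++ L.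
  by rewrite map_cat catrev_cat map_nseq catrevE rev_nseq.
have h1 : execp (movep i0 Left) (mk (cur (nseq z (Some false) ++ L) [::]) t1 t2 A)
    (mk (cur (behead (nseq z (Some false) ++ L)) (head None (nseq z (Some false) ++ L) :: nseq 0 None)) t1 t2 A) 2.
  apply: exec_eqt (@execp_move0 Left _ t1 t2 A) => // j.
  by elim/idxP: j => [|||c]; rewrite !mkE //; apply: move_left_cur.
have h3 := @execp_move0 Right (cur (behead L) (head None L :: nseq (0 + z) None)) t1 t2 A.
rewrite e0; apply: exec_leq (exec_eqt _ _ (execp_seq h1 (execp_seq (gen z 0) h3))) => //; first lia.
move=> j; elim/idxP: j => [|||c]; rewrite !mkE // -/L.
apply: eqt_cur => i; last by rewrite nth_nseq if_same nth_nil.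
have : size L != 0 by rewrite /L catrevE size_cat addnS.
by case: (L).
Qed.

Definition rightsp (k : nat) : prog := iter k (seqp (movep i0 Right)) skipp.

Lemma execp_rights k l s t1 t2 A :
  exists l', execp (rightsp k) (mk (cur l s) t1 t2 A) (mk (cur l' (drop k s)) t1 t2 A) (3 * k).
Proof.
elim: k => [|k IHk] in l s *; first by exists l; rewrite drop0; apply: execp_skip.
have [l' h'] := IHk (head None s :: l) (behead s); exists l'.
have -> : drop k.+1 s = drop k (behead s) by rewrite -drop1 drop_drop addn1.
by apply: exec_leq (execp_seq (@execp_move0 Right (cur l s) t1 t2 A) h'); lia.
Qed.

Definition signp : prog := dop (fun _ _ _ _ => (put (Some false) Stay, keep, keep, kept)).

(* The transducer divides by the odd part of [d] only, so the first [k] bits of its output are zeros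
   (or missing, if the result is 0); they are skipped, and the sign bit goes
   into the cell before the remaining bits. *)
Definition outputp (k : nat) : prog :=
  seqp erasep (seqp (rewindp i0) (seqp (movep i0 Left) (seqp (rightsp k) signp))).

Lemma execp_output k (s : bitstring) z l t1 t2 A :
  (s == [::]) || last false s ->
  exists2 T, string_on (T i0) = false :: drop k s &
  execp (outputp k) (mk (cur (catrev (map Some (s ++ nseq z false)) (None :: l)) [::]) t1 t2 A)
    T (size s + z + 3 * k + 22).
Proof.
move=> hs.
have h1 := @execp_erase s z l t1 t2 A hs.
have h2 := @execp_rewind0 s (None :: l) [::] t1 t2 A erefl.
have h3 : execp (movep i0 Left) (mk (cur (None :: l) (map Some s ++ [::])) t1 t2 A)
    (mk (cur l (None :: map Some s)) t1 t2 A) 2.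
  apply: exec_eqt (@execp_move0 Left _ t1 t2 A) => // j.
  elim/idxP: j => [|||c]; rewrite !mkE // cats0; exact: (move_left_cur (None :: l)).
have [l' h4] := execp_rights k l (None :: map Some s) t1 t2 A.
have h5 : execp signp (mk (cur l' (drop k (None :: map Some s))) t1 t2 A)
   (mk (cur l' (map Some (false :: drop k s))) t1 t2 A) 2.
  apply: exec_eqt (@execp_do _ _ _ _ _) => // j; elim/idxP: j => [|||c]; rewrite !mkE //=.
  rewrite /apply_cmd /= /write /= map_drop.
  by rewrite -drop1 drop_drop add1n.
exists (mk (cur l' (map Some (false :: drop k s))) t1 t2 A).
  by rewrite mkE string_on_cur.
by apply: exec_leq (execp_seq h1 (execp_seq h2 (execp_seq h3 (execp_seq h4 h5)))); lia.
Qed.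

(** * Combining the answers *)

Section Arithmetic.
Variables (coef : 'I_K -> int) (odd_div bound : nat).
Hypothesis odd_div_odd : odd odd_div.
Hypothesis boundP : (\sum_a `|coef a| + odd_div <= bound)%N.

(** The integers from [-bound] to [bound], shifted by [bound] to form a finite set of states. *)
Definition carry := 'I_(bound + bound).+1.
Definition dec (c : carry) : int := (c%:Z - bound%:Z)%R.
Definition enc (z : int) : carry := inord (absz (z + bound%:Z)%R).

Lemma encK (z : int) : `|z|%N <= bound -> dec (enc z) = z.
Proof.
move=> hz; rewrite /dec /enc inordK; last by rewrite ltnS; lia.
by lia.
Qed.

(** [code_int] gives a sign and an absolute value: a negative answer is treated by negating its
    coefficient. *)
Definition signed (sg : {ffun 'I_K -> bool}) (a : 'I_K) : int :=
  if sg a then (- coef a)%R else coef a.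

Definition arith_sum (sg : {ffun 'I_K -> bool}) (c : int) (sa : {ffun 'I_K -> symbol}) : int :=
  (c + \sum_a signed sg a * (sa a == Some true)%:Z)%R.

Definition arith_state := option ({ffun 'I_K -> bool} * carry)%type.

(* The invariant is [odd_div * y = carry + sum of signed coef * (unread part of the answer)], where [y] is
   the part of the quotient still to be written; as [odd_div] is odd, the parity of the right-hand side is
   the next bit of [y].  The initial state [None] reads the signs. *)
Definition arith_step (q : arith_state) (s0 s1 s2 : symbol) (sa : {ffun 'I_K -> symbol}) :
    option (arith_state * cmds) :=
  if q is Some (sg, c) then
    if [forall a, sa a == None] && (dec c == 0)%R then None
    else
      let t := arith_sum sg (dec c) sa in
      let b := odd `|t| in
      Some (Some (sg, enc ((t - odd_div%:Z * b%:Z) %/ 2)%Z),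
            (put (Some b) Right, keep, keep, fun _ => go Right))
  else Some (Some ([ffun a => sa a == Some true], enc 0),
             (keep, keep, keep, fun _ => go Right)).

Definition arithp : prog := trp (None : arith_state) arith_step.

Lemma bval_behead (s : bitstring) : bval s = (ohead s == Some true) + (bval (behead s)).*2.
Proof. by case: s => //= -[]. Qed.

Lemma odd_absz_add (t z : int) (b : bool) :
  (t = odd_div%:Z * b%:Z + 2 * z)%R -> odd `|t| = b.
Proof. by move=> ->; case: b; lia. Qed.

Lemma sum_bits_le sg (c : 'I_K -> bool) :
  `|(\sum_a signed sg a * (c a)%:Z)%R|%N <= \sum_a `|coef a|.
Proof.
apply: (big_ind2 (fun (x : int) y => `|x|%N <= y)) => // [x1 x2 y1 y2 h1 h2|a _]; first lia.
by rewrite /signed; case: (sg a); case: (c a); lia.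
Qed.

(** Induction on [X], which bounds both the unread bits of every answer and the bits of [y]. At
    [X = 0] all of these are used up, and the invariant forces the carry to be 0. *)
Lemma exec_arith X sg (y : nat) (c : int) (bits : 'I_K -> bitstring) l la t1 t2 :
  `|c|%N <= bound -> (forall a, size (bits a) <= X) -> y < 2 ^ X ->
  (odd_div%:Z * y%:Z = c + \sum_a signed sg a * (bval (bits a))%:Z)%R ->
  exists2 out : bitstring, bval out = y /\ size out <= X & exists A',
  exec (p := arithp) (Some (Some (sg, enc c)))
    (mk (cur l [::]) t1 t2 (fun a => cur (la a) (map Some (bits a))))
    (mk (cur (catrev (map Some out) l) [::]) t1 t2 A') X.+1.
Proof.
elim: X => [|X IHX] in y c bits l la * => hc hbits hy e.
  have bits0 a : bits a = [::] by apply/size0nil/eqP; rewrite -leqn0.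
  have y0 : y = 0 by move: hy; rewrite expn0; lia.
  have c0 : c = 0%R.
    move: e; rewrite y0 mulr0 big1 ?addr0 // => a _.
    by rewrite bits0 mulr0.
  exists [::] => //; eexists; apply: exec_tr_stop.
  rewrite /= encK // c0 eqxx andbT ifT //; apply/forallP=> a.
  by rewrite ffunE bits0.
(* The transducer may stop before [X] is exhausted; the invariant then gives [y = 0], because
   [odd_div] is odd and hence positive. *)
have [/andP[/forallP hb /eqP c0]|nstop] := boolP ([forall a, bits a == [::]] && (c == 0)%R).
  have y0 : y = 0.
    move: e; rewrite c0 big1 ?addr0 => [|a _]; last by rewrite (eqP (hb a)) mulr0.
    by move=> e; nia.
  exists [::] => //; eexists; apply: exec_leq; last apply: exec_tr_stop; first by [].
  rewrite /= encK // c0 eqxx andbT ifT //; apply/forallP=> a.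
  by rewrite ffunE (eqP (hb a)).
pose hd a := ohead (bits a) == Some true.
pose t := (c + \sum_a signed sg a * (hd a)%:Z)%R.
(* The next carry, as dictated by the invariant for [y./2] and the remaining bits. *)
pose z := (odd_div%:Z * (y./2)%:Z - \sum_a signed sg a * (bval (behead (bits a)))%:Z)%R.
have e2 : (t = odd_div%:Z * (odd y)%:Z + 2 * z)%R.
  have : (\sum_a signed sg a * (bval (bits a))%:Z = \sum_a signed sg a * (hd a)%:Z +
     2 * \sum_a signed sg a * (bval (behead (bits a)))%:Z)%R.
    rewrite mulr_sumr -big_split; apply: eq_bigr => a _ /=.
    by rewrite [bval (bits a)]bval_behead -/(hd a) PoszD -muln2 PoszM; ring.
  rewrite /t /z => e3; have -> : c = (odd_div%:Z * y%:Z -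
    \sum_a signed sg a * (bval (bits a))%:Z)%R by rewrite e; ring.
  rewrite e3 -{1}(odd_double_half y) PoszD -muln2 PoszM; ring.
have bE : odd `|t| = odd y by apply: odd_absz_add e2.
have zE : ((t - odd_div%:Z * (odd y)%:Z) %/ 2)%Z = z.
  by rewrite e2 addrC addKr mulrC mulzK.
(* [2 * z] differs from [c] by at most the sum of the [|coef a|] plus [odd_div], so by at most
   [bound]; halving stays in range. *)
have hz : `|z|%N <= bound.
  have := sum_bits_le sg hd.
  move: e2 boundP hc; rewrite /t; case: (odd y); lia.
have [| | | | out [out_y out_X] [A' h]] := IHX y./2 z (fun a => behead (bits a)) (Some (odd y) :: l)
    (fun a => ohead (bits a) :: la a).
- exact: hz.
- by move=> a; rewrite size_behead; have := hbits a; lia.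
- by rewrite -divn2 ltn_divLR // mulnC -expnS.
- by rewrite /z subrK.
exists (odd y :: out).
  by rewrite /= out_y odd_double_half.
exists A'; apply: exec_tr_step.
  rewrite /= encK //.
  have -> : [forall a, [ffun a => scanned (cur (la a) (map Some (bits a)))] a == None] =
      [forall a, bits a == [::]].
    by apply: eq_forallb => a; rewrite ffunE /=; case: (bits a).
  rewrite (negbTE nstop).
  have -> : arith_sum sg c [ffun a => scanned (cur (la a) (map Some (bits a)))] = t.
    by congr (_ + _)%R; apply: eq_bigr => a _; rewrite ffunE /hd /=; case: (bits a).
  rewrite bE zE; reflexivity.
apply: exec_eqt h => // j; elim/idxP: j => [|||a]; rewrite !mkE //.
by case: (bits a).
Qed.

Lemma execp_arith X (y : nat) (ans : 'I_K -> int) l t1 t2 :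
  (forall a, size (code_nat `|ans a|) <= X) -> y < 2 ^ X ->
  (odd_div%:Z * y%:Z = \sum_a coef a * ans a)%R ->
  exists2 out : bitstring, bval out = y /\ size out <= X & exists A',
  execp arithp (mk (cur l [::]) t1 t2 (fun a => cur [::] (map Some (code_int (ans a)))))
    (mk (cur (catrev (map Some out) l) [::]) t1 t2 A') X.+2.
Proof.
move=> hX hy e; pose sg := [ffun a : 'I_K => (ans a < 0)%R].
have e' : (odd_div%:Z * y%:Z = 0 + \sum_a signed sg a * (bval (code_nat `|ans a|))%:Z)%R.
  rewrite add0r e; apply: eq_bigr => a _; rewrite bval_code_nat /signed ffunE.
  by case: ltP; lia.
have [|out oP [A' h]] := exec_arith l (fun a => [:: Some (ans a < 0)%R]) t1 t2 _ hX hy e'; first by [].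
exists out => //; exists A'.
apply: (exec_tr_step (c' := Some (sg, enc 0)) (a := (keep, keep, keep, fun _ => go Right))).
  rewrite /=; congr (Some (Some (_, _), _)).
  by apply/ffunP=> a; rewrite !ffunE /=; case: (_ < _)%R.
exact: h.
Qed.

End Arithmetic.

(** * The complete machine *)

Definition emptyp : prog :=
  seqp (dop (fun _ _ _ _ => (put (Some false) Right, keep, keep, kept)))
       (dop (fun _ _ _ _ => (put (Some true) Left, keep, keep, kept))).

(** For the empty graph the oracle would answer 0 although the count is 1, so the input, a single
    [false], is turned into the code of 1 without a query. *)
Lemma execp_empty t1 t2 A :
  exists2 T, string_on (T i0) = code_int 1 &
  execp emptyp (mk (cur [::] [:: Some false]) t1 t2 A) T 5.
Proof.
have h1 := @execp_do (fun _ _ _ _ => (put (Some false) Right, keep, keep, kept))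
  (cur [::] [:: Some false]) t1 t2 A.
have h2 := @execp_do (fun _ _ _ _ => (put (Some true) Left, keep, keep, kept))
  (cur [:: Some false] [::]) t1 t2 A.
by eexists; last exact: execp_seq h1 h2; rewrite mkE.
Qed.

Section Main.
Variables (coef : 'I_K -> int) (odd_div bound k : nat).
Hypothesis odd_div_odd : odd odd_div.
Hypothesis boundP : (\sum_a `|coef a| + odd_div <= bound)%N.
Variables (m : 'I_K -> nat) (B : 'I_K -> seq bitstring) (ab : 'I_K -> bitstring).

Definition mainp : prog :=
  ifp (fun s => s i0 == Some true)
    (seqp initp (seqp (queriesp m B ab (enum 'I_K)) (seqp endp (seqp (movep i0 Right)
      (seqp (arithp coef odd_div bound) (outputp k))))))
    emptyp.

Definition start (w : bitstring) : idx -> tape :=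
  mk (cur [::] (map Some w)) blank blank (fun _ => blank).

Lemma execp_main_empty :
  exists2 T, string_on (T i0) = code_int 1 & execp mainp (start [:: false]) T 6.
Proof.
have [T sT h] := execp_empty blank blank (fun _ => blank).
by exists T => //; apply: execp_if_false h; rewrite ffunE mkE.
Qed.

Definition main_time (sw n X : nat) (sq : 'I_K -> nat) : nat :=
  \sum_a (build_time (m a) n + sq a + sw + 2 * X + 33) + 3 * n + sw + 2 * X + 3 * k + 60.

Lemma execp_main n row0 rows (ans : 'I_K -> int) (y X : nat)
    (w := input_string n row0 rows) (q := fun a => glue_string (m a) (B a) (ab a) n row0 rows) :
  (forall a, size (B a) = m a) -> (forall a, all (fun b => size b == (m a).+1) (B a)) ->
  (forall a, size (ab a) = m a) ->
  size row0 = n.+1 -> size rows = n -> all (fun r => size r == n.+1) rows ->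
  (forall a, f (q a) = code_int (ans a)) ->
  (forall a, size (code_nat `|ans a|) <= X) -> 2 ^ k * y < 2 ^ X ->
  (odd_div%:Z * (2 ^ k * y)%N%:Z = \sum_a coef a * ans a)%R ->
  exists2 T, string_on (T i0) = code_int y%:Z &
    execp mainp (start w) T (main_time (size w) n X (fun a => size (q a))).
Proof.
move=> sB aB sab sr0 srows arows fq hX hy e.
have h1 := @execp_init n (row0 ++ flatten rows) blank (fun _ => blank).
have h2 := execp_queries sB aB sab sr0 srows arows fq (enum_uniq 'I_K) (A := fun _ => blank)
  (fun _ _ => erefl).
have {}h2 : execp (queriesp m B ab (enum 'I_K)) (mk (cur [::] (map Some w)) blank (counter n) (fun=> blank))
    (mk (cur [::] (map Some w)) blank (counter n) (fun a => cur [::] (map Some (code_int (ans a)))))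
    (\sum_a (build_time (m a) n + size (q a) + size w + 2 * X + 33)).
  apply: exec_leq (exec_eqt _ _ h2) => //.
    rewrite big_enum; apply: leq_sum => a _; rewrite /= -/w -/(q a).
    by have := hX a; rewrite /= ; lia.
  by move=> j; elim/idxP: j => [|||a]; rewrite !mkE // mem_enum.
pose L := catrev (map Some w) [::].
have h3 := @execp_end w [::] blank (counter n) (fun a => cur [::] (map Some (code_int (ans a)))).
(* This move leaves a blank between input and output: rewinding stops there, and for [k = 0] that
   cell receives the sign. *)
have h4 := @execp_move0 Right (cur L [::]) blank (counter n)
  (fun a => cur [::] (map Some (code_int (ans a)))).
have [out [out_y out_X] [A' h5]] := execp_arith odd_div_odd boundP (None :: L) blank (counter n) hX hy e.
have [u hu [z out_u]] := strip_zeros out.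
have [T sT h6] := @execp_output k u z L blank (counter n) A' hu.
exists T.
  (* [u] is the code of [2 ^ k * y], so dropping [k] bits leaves the code of [y]. *)
  rewrite sT -(code_nat_bval hu) -(bval_cat_false u z) -out_u out_y drop_code_nat.
  by [].
rewrite -out_u in h6.
have h := execp_seq h1 (execp_seq h2 (execp_seq h3 (execp_seq h4 (execp_seq h5 h6)))).
have sz : size u + z <= X by move: out_X; rewrite out_u size_cat size_nseq.
have ht : (fun s : {ffun idx -> symbol} => s i0 == Some true) (scanf (start w)).
  by rewrite ffunE /start mkE.
have h' : execp mainp (start w) T _ := execp_if_true emptyp ht h.
by apply: exec_leq h'; rewrite /main_time; lia.
Qed.

End Main.
End Programs.

(** * Polynomially bounded functions *)

Definition polyb (g : nat -> nat) : Prop := exists c d, forall n, g n <= c * n ^ d + c.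

Lemma polyb_const c : polyb (fun _ => c).
Proof. by exists c, 0 => n; rewrite leq_addl. Qed.

Lemma polyb_id : polyb id.
Proof. by exists 1, 1 => n; rewrite mul1n expn1 leq_addr. Qed.

Lemma polyb_ext g h : g =1 h -> polyb g -> polyb h.
Proof. by move=> e [c [d le]]; exists c, d => n; rewrite -e. Qed.

(** The summand 1 covers [n = 0] and [d = 0], where the left side is 1 and the power on the right
    may be 0. *)
Lemma expn_leq_addr n d d' : n ^ d <= n ^ (d + d') + 1.
Proof.
case: n => [|n]; first by case: d => [|d]; [rewrite expn0 addn1 | rewrite exp0n].
by apply: leq_trans (leq_addr _ _); rewrite leq_pexp2l ?leq_addr.
Qed.

Lemma polybD g h : polyb g -> polyb h -> polyb (fun n => g n + h n).
Proof.
move=> [c [d le]] [c' [d' le']]; exists (2 * (c + c')), (d + d') => n.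
have := le n; have := le' n.
have := expn_leq_addr n d d'; have := expn_leq_addr n d' d; rewrite [d' + d]addnC; nia.
Qed.

Lemma polybM g h : polyb g -> polyb h -> polyb (fun n => g n * h n).
Proof.
move=> [c [d le]] [c' [d' le']]; exists (3 * (c * c')), (d + d') => n.
apply: leq_trans (leq_mul (le n) (le' n)) _.
have := expn_leq_addr n d d'; have := expn_leq_addr n d' d; rewrite [d' + d]addnC expnD.
move: (n ^ d) (n ^ d') => a b h1 h2.
have -> : (c * a + c) * (c' * b + c') = (c * c') * (a * b + a + b + 1) by ring.
have le3 : a * b + a + b + 1 <= 3 * (a * b) + 3 by lia.
by apply: leq_trans (leq_mul (leqnn (c * c')) le3) _; apply: eq_leq; ring.
Qed.

Lemma polyb_sum (I : finType) (g : I -> nat -> nat) :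
  (forall i, polyb (g i)) -> polyb (fun n => \sum_i g i n).
Proof.
move=> h; elim: (index_enum I) => [|i r IHr].
  by apply: polyb_ext (polyb_const 0) => n; rewrite big_nil.
by apply: polyb_ext (polybD (h i) IHr) => n; rewrite big_cons.
Qed.

(** * The reduction *)

(** The vertices of a glued graph are enumerated gadget first, which fixes the block layout of its
    code. *)
Lemma enum_sum (S T : finType) :
  enum {: S + T} = map inl (enum S) ++ map inr (enum T).
Proof. by rewrite !enumT [in LHS]unlock. Qed.

Lemma map_enum_sum (S T : finType) (U : Type) (h : S + T -> U) :
  map h (enum {: S + T}) = [seq h (inl x) | x <- enum S] ++ [seq h (inr y) | y <- enum T].
Proof. by rewrite enum_sum; move: (enum S) (enum T) => s t; rewrite map_cat -!map_comp. Qed.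

Definition adj_row (G : graph) (x : G) : bitstring := [seq adj x y | y <- enum G].

Lemma code_graphE (G : graph) :
  code_graph G = nseq #|G| true ++ false :: flatten [seq adj_row x | x <- enum G].
Proof. by []. Qed.

Lemma size_code_graph (G : graph) : size (code_graph G) = #|G| + (#|G| * #|G|).+1.
Proof. by rewrite size_cat size_nseq /= size_allpairs -cardE. Qed.

Lemma size_adj_row (G : graph) (x : G) : size (adj_row x) = #|G|.
Proof. by rewrite size_map -cardE. Qed.

Section GadgetStrings.
Variable X : gadget.

Definition gadget_rows : seq bitstring :=
  [seq rcons (adj_row d) (gadget_pred d) | d <- enum X].

Definition gadget_marks : bitstring := [seq gadget_pred d | d <- enum X].

Lemma size_gadget_rows : size gadget_rows = #|X|.
Proof. by rewrite size_map -cardE. Qed.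

Lemma all_gadget_rows : all (fun b => size b == #|X|.+1) gadget_rows.
Proof. by apply/allP=> _ /mapP[d _ ->]; rewrite size_rcons size_adj_row. Qed.

Lemma size_gadget_marks : size gadget_marks = #|X|.
Proof. by rewrite size_map -cardE. Qed.

Variables (G : graph) (v : G) (r : seq G).
Hypothesis enumG : enum G = v :: r.

Lemma card_enum : #|G| = (size r).+1.
Proof. by rewrite cardE enumG. Qed.

Lemma code_graph_input :
  code_graph G = input_string (size r) (adj_row v) [seq adj_row x | x <- r].
Proof. by rewrite code_graphE card_enum enumG. Qed.

Lemma marks_false (d : X) :
  [seq gadget_pred d && (x == v) | x <- r] = nseq (size r) false.
Proof.
have : v \notin r by have := enum_uniq G; rewrite enumG => /andP[].
elim: (r) => //= x s IHs; rewrite inE negb_or eq_sym => /andP[/negbTE-> /IHs->].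
by rewrite andbF.
Qed.

(** Since [v] is the first vertex of [G], a gadget row continues with its mark and then zeros, and
    among the rows of [G] only the first starts with the marks. *)
Lemma code_graph_glue :
  code_graph (glue (@gadget_pred X) v) =
  glue_string #|X| gadget_rows gadget_marks (size r) (adj_row v) [seq adj_row x | x <- r].
Proof.
rewrite code_graphE /glue_string card_sum nseqD -catA card_enum; congr (_ ++ (_ ++ _ :: _)).
rewrite map_enum_sum flatten_cat enumG /=.
have rowl (d : X) : @adj_row (glue (@gadget_pred X) v) (inl d) =
    rcons (adj_row d) (gadget_pred d) ++ nseq (size r) false.
  rewrite /adj_row map_enum_sum enumG /= eqxx andbT cat_rcons.
  by congr (_ ++ _ :: _); rewrite -(marks_false d).
have rowr (x : G) : @adj_row (glue (@gadget_pred X) v) (inr x) =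
    [seq gadget_pred d && (x == v) | d <- enum X] ++ adj_row x.
  by rewrite /adj_row map_enum_sum.
congr (_ ++ _).
  by rewrite /gadget_rows; elim: (enum X) => //= d s ->; rewrite rowl.
rewrite rowr eqxx -catA; congr (_ ++ _).
  by apply: eq_map => d; rewrite andbT.
congr (_ ++ flatten _); rewrite -map_comp; apply/eq_in_map => x xr /=.
rewrite rowr; congr (_ ++ _).
have /negbTE-> : x != v.
  by have := enum_uniq G; rewrite enumG => /andP[nv _]; apply: contraNneq nv => <-.
by rewrite cardE; elim: (enum X) => //= d s ->; rewrite andbF.
Qed.

End GadgetStrings.

Lemma hom_leq (G J : graph) : hom G J <= #|J| ^ #|G|.
Proof. by rewrite -card_ffun; apply: max_card. Qed.

Lemma odd_part d : 0 < d -> exists k e, odd e /\ d = 2 ^ k * e.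
Proof.
elim/ltn_ind: d => d IHd d_gt0; have [od|ed] := boolP (odd d).
  by exists 0, d; rewrite mul1n.
have e2 : d = 2 * d./2 by rewrite mul2n -[LHS]odd_double_half (negbTE ed).
have [||k [e [oe de]]] := IHd d./2; [lia | lia |].
by exists k.+1, e; split=> //; rewrite expnS -mulnA -de.
Qed.

Section Bounds.
Variable W : weighted_graph_set.

Definition weight_sum : nat := \sum_(i : wgs_index W) `|wgs_weight i|.
Definition card_sum_graphs : nat := \sum_(i : wgs_index W) #|wgs_graph i|.

Lemma card_graph_pow (i : wgs_index W) N : #|wgs_graph i| ^ N <= 2 ^ (card_sum_graphs * N).
Proof.
have [->|N_gt0] := posnP N; first by rewrite muln0.
rewrite expnM leq_exp2r //; apply: leq_trans (ltnW (ltn_expl _ (ltnSn 1))).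
by rewrite /card_sum_graphs (bigD1 i) //= leq_addr.
Qed.

(** For fixed [W] the answers have linearly many bits in the number of vertices, so processing them
    takes polynomial time. *)
Lemma output_bound (G : connected_irreflexive_graph) :
  `|@output (GSHomC W) G| < 2 ^ (weight_sum + card_sum_graphs * #|G|).
Proof.
rewrite /=; case: eqP => _; first by rewrite expn_gt0.
have le : `|(\sum_(i : wgs_index W) wgs_weight i * (hom G (wgs_graph i))%:Z)%R| <=
    \sum_(i : wgs_index W) `|wgs_weight i| * 2 ^ (card_sum_graphs * #|G|).
  apply: (big_ind2 (fun (x : int) y => `|x|%N <= y)) => // [x1 x2 y1 y2 h1 h2|i _]; first lia.
  rewrite abszM leq_mul2l absz_nat (leq_trans (hom_leq _ _)) ?orbT //.
  exact: card_graph_pow.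
apply: leq_ltn_trans le _; rewrite -big_distrl /= expnD ltn_pmul2r ?expn_gt0 //.
exact: ltn_expl.
Qed.

End Bounds.

Lemma computes_of_execp K f (p : prog K) w (T : 'I_K.+3 -> tape) t v :
  execp f p (start w) T t -> string_on (T (i0 K)) = v ->
  computes_within (machine p) f t w v.
Proof.
move=> h sT.
have [|T2 e2 /runs_iter[s les [q hq e]]] := h (cfg_tapes (initial_config (machine p) w)).
  move=> j; rewrite /= ffunE /start; elim/idxP: j => [|||a]; rewrite !mkE //.
  by rewrite eqxx tape_of_cur.
exists s => //=; rewrite (_ : initial_config _ _ =
  Config (M := machine p) (pstart p) (cfg_tapes (initial_config (machine p) w))) // e.
split; first by rewrite /halted /= hq.
by rewrite -sT; apply: string_on_eqt; apply: e2.
Qed.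

Lemma polybS g : polyb g -> polyb (fun n => (g n).+1).
Proof. by move=> h; apply: polyb_ext (polybD h (polyb_const 1)) => n; rewrite addn1. Qed.

(** The arguments are the code lengths of graphs with [n + 1] and [m a + n + 1] vertices, and a
    bound on the bits of the numbers involved. *)
Lemma polyb_main_time (K k M V : nat) (m : 'I_K -> nat) :
  polyb (fun n => main_time k m (n.+1 + (n.+1 * n.+1).+1) n (V * (M + n.+1) + k)
    (fun a => (m a + n.+1) + ((m a + n.+1) * (m a + n.+1)).+1)).
Proof.
rewrite /main_time /build_time.
repeat first [exact: polyb_id | exact: polyb_const | apply: polyb_sum => a
  | apply: polybD | apply: polybM | apply: polybS].
Qed.

Theorem theorem3p12 (W : weighted_graph_set)
    (cases :
      (forall J : wgs_index W, reflexive_graph (wgs_graph J)) \/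
      (forall J : wgs_index W,
         irreflexive_graph (wgs_graph J) /\ bipartite (wgs_graph J)))
    (H : wgs_index W) (weight_H : wgs_weight H <> 0%R) :
  poly_time_Turing_reducible (HomC (wgs_graph H)) (GSHomC W).
Proof.
have [K [m [X [d [d_gt0 hs]]]]] := hom_interpolation cases weight_H.
have [k [e [oe de]]] := odd_part d_gt0.
pose p := mainp m e (\sum_a `|m a| + e) k (fun a => #|X a|)
  (fun a => gadget_rows (X a)) (fun a => gadget_marks (X a)).
pose M := \sum_a #|X a|; pose L := weight_sum W; pose V := card_sum_graphs W.
(* A common bound on the bits of every answer and of [2 ^ k * y], where [y] is the count to be
   output; the latter accounts for the summand [k]. *)
pose Y n := (L + V + 1) * (M + n.+1) + k.
have [c [b hc]] := polyb_main_time k M (L + V + 1) (fun a => #|X a|).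
(* The 6 pays for the run on the empty graph. *)
exists (machine p), (c + 6), b => f fsolves G /=.
case enumG: (enum G) => [|v r].
  have G0 : #|G| = 0 by rewrite cardE enumG.
  have -> : code_graph G = [:: false] by rewrite code_graphE G0 enumG.
  have -> : hom G (wgs_graph H) = 1.
    rewrite /hom (_ : [set _ | _] = [set: {ffun G -> wgs_graph H}]).
      by rewrite cardsT card_ffun G0 expn0.
    apply/setP=> h; rewrite !inE; apply/is_homP => x.
    by have : x \in enum G; [rewrite mem_enum | rewrite enumG].
  have [T sT h] := execp_main_empty f m e (\sum_a `|m a| + e) k (fun a => #|X a|)
    (fun a => gadget_rows (X a)) (fun a => gadget_marks (X a)).
  apply: computes_of_execp sT; apply: exec_leq h.
  by rewrite exp1n muln1 addnA leq_addl.
have cardG := card_enum enumG.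
pose ans a := @output (GSHomC W) (glue_instance (X a) v).
pose y := hom G (wgs_graph H).
have cardX a : #|glue (@gadget_pred (X a)) v| = #|X a| + (size r).+1.
  by rewrite card_sum cardG.
have hX a : size (code_nat `|ans a|) <= Y (size r).
  apply: size_code_nat; apply: leq_trans (@output_bound W (glue_instance (X a) v)) _.
  rewrite leq_exp2l // cardX -/L -/V /Y.
  have : #|X a| <= M by rewrite /M (bigD1 a) //= leq_addr.
  by move=> leM; nia.
have hy : 2 ^ k * y < 2 ^ (Y (size r)).
  apply: (@leq_ltn_trans (2 ^ k * 2 ^ (V * #|G|))).
    by rewrite leq_mul2l (leq_trans (hom_leq _ _)) ?card_graph_pow ?orbT.
  by rewrite -expnD ltn_exp2l // cardG /Y; nia.
have he : (e%:Z * (2 ^ k * y)%N%:Z = \sum_a m a * ans a)%R.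
  by rewrite hs de -/y -!PoszM; congr Posz; rewrite mulnA [e * _]mulnC.
have fq a : f (glue_string #|X a| (gadget_rows (X a)) (gadget_marks (X a)) (size r)
    (adj_row v) [seq adj_row x | x <- r]) = code_int (ans a).
  by rewrite -(code_graph_glue (X a) enumG); apply: (fsolves (glue_instance (X a) v)).
have arows : all (fun u => size u == (size r).+1) [seq adj_row x | x <- r].
  by apply/allP=> _ /mapP[x _ ->]; rewrite size_adj_row cardG.
have [T sT h] := execp_main oe (leqnn _) (fun a => size_gadget_rows (X a))
  (fun a => all_gadget_rows (X a)) (fun a => size_gadget_marks (X a))
  (etrans (size_adj_row v) cardG) (size_map _ _) arows fq hX hy he.
rewrite (code_graph_input enumG); apply: computes_of_execp sT; apply: exec_leq h.
(* The input code has more than [size r] bits, so a polynomial bound in [size r] suffices. *)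
apply: (@leq_trans (c * size r ^ b + c)).
  apply: leq_trans (hc (size r)); rewrite -(code_graph_input enumG) size_code_graph cardG.
  rewrite /main_time !leq_add2r leq_sum // => a _.
  by rewrite -(code_graph_glue (X a) enumG) size_code_graph cardX.
rewrite -(code_graph_input enumG) size_code_graph cardG.
apply: leq_add; last exact: leq_addr.
apply: leq_mul; first exact: leq_addr.
have [->|b_gt0] := posnP b; first by rewrite !expn0.
by rewrite leq_exp2r //; lia.
Qed.
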